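(* Let $(A,G,\alpha)$ be a pre-ordered Banach algebra dynamical system (with $A$ having a closed cone). Let $\mathcal{R}$ be a uniformly bounded class of continuous covariant representations of $(A,G,\alpha)$ on Banach spaces. Then: (1) The pre-ordered crossed product $(A\rtimes_\alpha G)^{\mathcal{R}}$ is a pre-ordered Banach algebra with a closed cone. (2) If $A_+$ is generating in $A$, then $(A\rtimes_\alpha G)^{\mathcal{R}}_+$ is topologically generating in $(A\rtimes_\alpha G)^{\mathcal{R}}$. (3) If $A_+$ is generating in $A$ and $(\cdot)^+:q^{\mathcal{R}}(C_c(G,A))\to q^{\mathcal{R}}(C_c(G,A_+))$ is a function such that $q^{\mathcal{R}}(f)\le q^{\mathcal{R}}(f)^+$ for all $f\in C_c(G,A)$, and which maps $\|\cdot\|^{\mathcal{R}}$-Cauchy sequences to $\|\cdot\|^{\mathcal{R}}$-Cauchy sequences, then the cone $(A\rtimes_\alpha G)^{\mathcal{R}}_+$ is generating in $(A\rtimes_\alpha G)^{\mathcal{R}}$. (4) If $\mathcal{R}$ is a uniformly bounded class of positive continuous covariant representations of $(A,G,\alpha)$ on pre-ordered Banach spaces with closed cones such that, for every $(\pi,U)\in\mathcal{R}$, the cone $B(X_\pi)_+$ is proper, then $(A\rtimes_\alpha G)^{\mathcal{R}}_+$ is a proper cone. (5) Let $\beta>0$ and let $\mathcal{R}$ be a uniformly bounded class of positive continuous covariant representations of $(A,G,\alpha)$ on pre-ordered Banach spaces with closed cones. If, for every $(\pi,U)\in\mathcal{R}$, $B(X_\pi)$ is $\beta$-normal, then $(A\rtimes_\alpha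 G)^{\mathcal{R}}$ is $\beta$-normal; and if, for every $(\pi,U)\in\mathcal{R}$, $B(X_\pi)$ is $\beta$-absolutely normal, then $(A\rtimes_\alpha G)^{\mathcal{R}}$ is $\beta$-absolutely normal.
   Context: All vector spaces are real; algebras are associative and not assumed unital; locally compact spaces and groups are Hausdorff. A cone in a vector space $V$ is a subset $C$ with $C+C\subseteq C$ and $\lambda C\subseteq C$ for all $\lambda\ge0$. A pre-ordered vector space is a vector space $V$ with a chosen cone $V_+$; $x\le y$ means $y-x\in V_+$. The cone is proper if $V_+\cap(-V_+)=\{0\}$, generating if $V=V_+-V_+$, and, if $V$ is normed, topologically generating if $V=\overline{V_+-V_+}$. A pre-ordered algebra is an algebra and pre-ordered vector space with $V_+\cdot V_+\subseteq V_+$; a pre-ordered normed (Banach) algebra is a pre-ordered algebra that is also a normed (Banach) algebra. A linear map is positive if it maps the cone into the cone. For pre-ordered normed spaces, $B(X,Y)_+=\{T\in B(X,Y):TX_+\subseteq Y_+\}$; $B(X)=B(X,X)$. A pre-ordered Banach space $X$ with closed cone is $\beta$-normal if $0\le x\le y$ implies $\|x\|\le\beta\|y\|$, and $\beta$-absolutely normal if $\pm x\le y$ implies $\|x\|\le\beta\|y\|$. The completion of a pre-ordered normed space $V$ is its metric completion $\overline V$ with cone the closure $\overline{V_+}$ of $V_+$ in $\overline V$. $\mathrm{Inv}(X)$ is the group of invertible elements of $B(X)$ and $\mathrm{Inv}_+(X)=\{T\in\mathrm{Inv}(X):T^{\pm1}X_+\subseteq X_+\}$. $\mathrm{Aut}(A)$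 is the group of bounded automorphisms of $A$ and $\mathrm{Aut}_+(A)=\{\beta\in\mathrm{Aut}(A):\beta^{\pm1}(A_+)\subseteq A_+\}$. A representation of a normed algebra $A$ on a normed space $X$ is an algebra homomorphism $\pi:A\to B(X)$ (also write $X=X_\pi$), positive if $\pi(A_+)\subseteq B(X)_+$. A representation of $G$ on $X$ is a group homomorphism $U:G\to\mathrm{Inv}(X)$, positive if it takes values in $\mathrm{Inv}_+(X)$. A pre-ordered Banach algebra dynamical system $(A,G,\alpha)$ consists of a pre-ordered Banach algebra $A$ with closed cone, a locally compact group $G$ and a strongly continuous homomorphism $\alpha:G\to\mathrm{Aut}_+(A)$. A covariant representation of $(A,G,\alpha)$ on $X$ is a pair $(\pi,U)$ of representations of $A$ and $G$ on $X$ with $\pi(\alpha_s(a))=U_s\pi(a)U_s^{-1}$; it is continuous if $\pi$ is bounded and $U$ strongly continuous, and positive if $\pi$ and $U$ are positive. $C_c(G,A)$ (continuous compactly supported functions) is an algebra under twisted convolution $(f*g)(s)=\int_G f(r)\alpha_r(g(r^{-1}s))\,dr$ (left Haar measure). For a continuous covariant representation $(\pi,U)$ on a Banach space $X$, the integrated form is $\pi\rtimes U:C_c(G,A)\to B(X)$, $\pi\rtimes U(f)x=\int_G\pi(f(r))U_rx\,dr$. A (non-empty) class $\mathcal{R}$ of continuous covariant representations on Banach spaces is uniformly bounded if there are $C\ge0$ and $\nu:G\to\mathbb{R}_{\ge0}$ bounded on compact sets with $\|\pi\|\le C$, $\|U_r\|\le\nu(r)$ for all $(\pi,U)\in\mathcal{R}$,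 $r\in G$. Then $\sigma^{\mathcal{R}}(f)=\sup_{(\pi,U)\in\mathcal{R}}\|\pi\rtimes U(f)\|$ is a finite algebra seminorm on $C_c(G,A)$. The quotient $C_c(G,A)/\ker\sigma^{\mathcal{R}}$, with quotient map $q^{\mathcal{R}}$, has the induced norm $\|\cdot\|^{\mathcal{R}}$ and the cone $q^{\mathcal{R}}(C_c(G,A_+))$ (this defines the order in (3)). The pre-ordered crossed product $(A\rtimes_\alpha G)^{\mathcal{R}}$ is its completion as a pre-ordered normed space, with the extended multiplication; its cone, the closure of $q^{\mathcal{R}}(C_c(G,A_+))$, is denoted $(A\rtimes_\alpha G)^{\mathcal{R}}_+$. *)

(* Defs.v *)
From HB Require Import structures.
From mathcomp Require Import all_boot all_order all_algebra.
From mathcomp Require Import generic_quotient.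
From mathcomp Require Import all_classical all_reals all_analysis.

Set Implicit Arguments.
Unset Strict Implicit.
Unset Printing Implicit Defensive.

Import Order.TTheory GRing.Theory Num.Theory.
Import numFieldNormedType.Exports.

Local Open Scope classical_set_scope.
Local Open Scope ring_scope.

Section BoundedLinear.
Context {R : realType} (X Y : normedModType R).

Definition is_bounded_linear (T : X -> Y) : Prop :=
  linear T /\ exists M : R, forall x, `|T x| <= M * `|x|.

Definition bl_pred : {pred (X -> Y)} := fun T => `[< is_bounded_linear T >].

Record bounded_linear := BoundedLinear {
  bl_fun :> X -> Y ;
  bl_subproof : bl_fun \in bl_pred }.

HB.instance Definition _ := [isSub for bl_fun].
HB.instance Definition _ := [Choice of bounded_linear by <:].

Lemma bl_submod_closed : submod_closed bl_pred.
Proof.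
split.
  apply/asboolP; split=> [a x y|]; first by rewrite scaler0 addr0.
  by exists 0 => x; rewrite normr0 mul0r.
move=> a S T /asboolP[linS [M HM]] /asboolP[linT [N HN]].
apply/asboolP; split=> [b x y|].
  rewrite !fctE linS linT !scalerDr !scalerA [a * b]mulrC.
  by rewrite addrACA.
exists (`|a| * M + N) => x; rewrite !fctE mulrDl -mulrA.
rewrite (le_trans (ler_normD _ _)) // lerD // normrZ.
by rewrite ler_wpM2l // normr_ge0.
Qed.

HB.instance Definition _ :=
  GRing.isSubmodClosed.Build R (X -> Y) bl_pred bl_submod_closed.
HB.instance Definition _ :=
  [SubChoice_isSubLmodule of bounded_linear by <:].

Lemma blP (T : bounded_linear) : is_bounded_linear T.
Proof. by case: T => T /= /asboolP. Qed.

Definition opnorm (T : bounded_linear) : R :=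
  sup [set `|T x| | x in [set x : X | `|x| <= 1]].

Lemma opnorm_has_sup (T : bounded_linear) :
  has_sup [set `|T x| | x in [set x : X | `|x| <= 1]].
Proof.
split; first by exists `|T 0|; exists 0 => //=; rewrite normr0.
have [_ [M HM]] := blP T; exists `|M| => _ /= [x x1 <-].
rewrite (le_trans (HM x)) // (le_trans (ler_wpM2r _ (ler_norm M))) //.
by rewrite ler_piMr.
Qed.

Lemma opnorm_ge0 (T : bounded_linear) : 0 <= opnorm T.
Proof.
apply: (le_trans (normr_ge0 (T 0))); apply: (ub_le_sup (opnorm_has_sup T).2).
by exists 0 => //=; rewrite normr0.
Qed.

Lemma le_opnorm (T : bounded_linear) (x : X) : `|T x| <= opnorm T * `|x|.
Proof.
have [linT [M HM]] := blP T.
have [->|x0] := eqVneq x 0.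
  by have := HM 0; rewrite normr0 !mulr0.
have nx : 0 < `|x| by rewrite normr_gt0.
have TZ a y : T (a *: y) = a *: T y.
  have T0 : T 0 = 0.
    by have := linT 1 0 0; rewrite !scale1r addr0 => /(congr1 (+%R^~ (- T 0))); rewrite addrK subrr.
  by have := linT a y 0; rewrite T0 !addr0.
rewrite -ler_pdivrMr //; apply: (ub_le_sup (opnorm_has_sup T).2).
exists (`|x|^-1 *: x); first by rewrite /= normrZ normfV normr_id mulVf ?gt_eqF.
by rewrite TZ normrZ normfV normr_id mulrC.
Qed.

Lemma opnorm_le (T : bounded_linear) (M : R) :
  (forall x, `|x| <= 1 -> `|T x| <= M) -> opnorm T <= M.
Proof.
move=> TM; apply: ge_sup; first exact: (opnorm_has_sup T).1.
by move=> _ [x x1 <-]; exact: TM.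
Qed.

Lemma opnormD (S T : bounded_linear) : opnorm (S + T) <= opnorm S + opnorm T.
Proof.
apply: opnorm_le => x x1; rewrite (le_trans (ler_normD _ _)) // lerD //.
- by rewrite (le_trans (le_opnorm S x)) // ler_piMr // opnorm_ge0.
- by rewrite (le_trans (le_opnorm T x)) // ler_piMr // opnorm_ge0.
Qed.

Lemma opnormZ_le (a : R) (T : bounded_linear) :
  opnorm (a *: T) <= `|a| * opnorm T.
Proof.
apply: opnorm_le => x x1.
rewrite [X in `|X|](_ : _ = a *: T x) // normrZ ler_wpM2l //.
by rewrite (le_trans (le_opnorm T x)) // ler_piMr // opnorm_ge0.
Qed.

Lemma opnormZ (a : R) (T : bounded_linear) :
  opnorm (a *: T) = `|a| * opnorm T.
Proof.
apply/eqP; rewrite eq_le opnormZ_le /=.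
have [->|a0] := eqVneq a 0; first by rewrite normr0 mul0r opnorm_ge0.
have := opnormZ_le a^-1 (a *: T); rewrite scalerA mulVf // scale1r normfV.
by rewrite mulrC ler_pdivlMr ?normr_gt0 // mulrC.
Qed.

Lemma opnorm_eq0 (T : bounded_linear) : opnorm T = 0 -> T = 0.
Proof.
move=> T0; apply: val_inj; apply/funext => x /=.
by apply/eqP; rewrite -normr_le0 (le_trans (le_opnorm T x)) // T0 mul0r.
Qed.

HB.instance Definition _ :=
  Lmodule_isNormed.Build R bounded_linear opnormD opnormZ opnorm_eq0.

End BoundedLinear.

Notation "''B' ( X , Y )" := (bounded_linear X Y)
  (at level 8, format "''B' ( X ,  Y )") : type_scope.

Record is_seminorm {R : realType} (V : lmodType R) (N : V -> R) : Prop :=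
  IsSeminorm {
    seminorm_triangle : forall x y, N (x + y) <= N x + N y ;
    seminorm_scale : forall (a : R) x, N (a *: x) = `|a| * N x }.

Section SeminormQuotient.
Context {R : realType} {V : lmodType R} {N : V -> R} (HN : is_seminorm N).

Let N0 : N 0 = 0.
Proof. by rewrite -(scale0r 0) (seminorm_scale HN) normr0 mul0r. Qed.

Let NN x : N (- x) = N x.
Proof. by rewrite -scaleN1r (seminorm_scale HN) normrN normr1 mul1r. Qed.

Let N_ge0 x : 0 <= N x.
Proof.
have := seminorm_triangle HN x (- x); rewrite subrr N0 NN -mulr2n.
by rewrite pmulrn_lge0.
Qed.

Definition seminorm_rel (x y : V) : bool := N (x - y) == 0.

Let rel_refl : reflexive seminorm_rel.
Proof. by move=> x; rewrite /seminorm_rel subrr N0. Qed.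
Let rel_sym : symmetric seminorm_rel.
Proof. by move=> x y; rewrite /seminorm_rel -NN opprB. Qed.
Let rel_trans : transitive seminorm_rel.
Proof.
move=> y x z; rewrite /seminorm_rel => /eqP xy /eqP yz.
rewrite eq_le N_ge0 andbT -(subrKA y) (le_trans (seminorm_triangle HN _ _)) //.
by rewrite xy yz addr0.
Qed.

Canonical seminorm_equiv := EquivRel seminorm_rel rel_refl rel_sym rel_trans.

Definition seminorm_quot : Type := {eq_quot seminorm_equiv}%qT.
HB.instance Definition _ := Choice.on seminorm_quot.

Definition seminorm_pi (x : V) : seminorm_quot := \pi_({eq_quot seminorm_equiv})%qT x.
Let rep (c : seminorm_quot) : V := repr (c : {eq_quot seminorm_equiv}%qT).

Let repK c : seminorm_pi (rep c) = c.
Proof. exact: reprK. Qed.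

Lemma seminorm_piP x y : seminorm_pi x = seminorm_pi y <-> N (x - y) = 0.
Proof.
split=> [/eqP|xy].
  by rewrite eqmodE => /eqP.
by apply/eqP; rewrite eqmodE; apply/eqP.
Qed.

Let pi_rep x : N (rep (seminorm_pi x) - x) = 0.
Proof. by apply/seminorm_piP; rewrite repK. Qed.

Definition seminorm_quot_zero : seminorm_quot := seminorm_pi 0.
Definition seminorm_quot_add (c d : seminorm_quot) := seminorm_pi (rep c + rep d).
Definition seminorm_quot_opp (c : seminorm_quot) := seminorm_pi (- rep c).
Definition seminorm_quot_scale (a : R) (c : seminorm_quot) :=
  seminorm_pi (a *: rep c).
Definition seminorm_quot_norm (c : seminorm_quot) : R := N (rep c).

Let N_eq0D x y : N x = 0 -> N y = 0 -> N (x + y) = 0.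
Proof.
move=> x0 y0; apply/eqP; rewrite eq_le N_ge0 andbT.
by rewrite (le_trans (seminorm_triangle HN _ _)) // x0 y0 addr0.
Qed.

Let piD x y :
  seminorm_quot_add (seminorm_pi x) (seminorm_pi y) = seminorm_pi (x + y).
Proof.
by apply/seminorm_piP; rewrite opprD addrACA; apply: N_eq0D; exact: pi_rep.
Qed.

Let piN x : seminorm_quot_opp (seminorm_pi x) = seminorm_pi (- x).
Proof. by apply/seminorm_piP; rewrite -opprD NN; exact: pi_rep. Qed.

Let piZ a x : seminorm_quot_scale a (seminorm_pi x) = seminorm_pi (a *: x).
Proof.
by apply/seminorm_piP; rewrite -scalerBr (seminorm_scale HN) pi_rep mulr0.
Qed.

Let pi_norm x : seminorm_quot_norm (seminorm_pi x) = N x.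
Proof.
apply/eqP; rewrite eq_le; apply/andP; split.
  have := seminorm_triangle HN (rep (seminorm_pi x) - x) x.
  by rewrite subrK pi_rep add0r.
have := seminorm_triangle HN (x - rep (seminorm_pi x)) (rep (seminorm_pi x)).
by rewrite subrK -[N (x - _)]NN opprB pi_rep add0r.
Qed.

Let elimq (P : seminorm_quot -> Prop) : (forall x, P (seminorm_pi x)) -> forall c, P c.
Proof. by move=> H c; rewrite -(repK c). Qed.

Let addqA : associative seminorm_quot_add.
Proof.
by elim/elimq=> x; elim/elimq=> y; elim/elimq=> z; rewrite !piD addrA.
Qed.
Let addqC : commutative seminorm_quot_add.
Proof. by elim/elimq=> x; elim/elimq=> y; rewrite !piD addrC. Qed.
Let add0q : left_id seminorm_quot_zero seminorm_quot_add.
Proof. by elim/elimq=> x; rewrite piD add0r. Qed.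
Let addNq : left_inverse seminorm_quot_zero seminorm_quot_opp seminorm_quot_add.
Proof. by elim/elimq=> x; rewrite piN piD addNr. Qed.

HB.instance Definition _ :=
  GRing.isZmodule.Build seminorm_quot addqA addqC add0q addNq.

Let addE x y : seminorm_pi x + seminorm_pi y = seminorm_pi (x + y).
Proof. exact: piD. Qed.

Let scaleqA a b c : seminorm_quot_scale a (seminorm_quot_scale b c) =
  seminorm_quot_scale (a * b) c.
Proof. by elim/elimq: c => x; rewrite !piZ scalerA. Qed.
Let scale1q : left_id 1 seminorm_quot_scale.
Proof. by elim/elimq=> x; rewrite piZ scale1r. Qed.
Let scaleqDr : right_distributive seminorm_quot_scale +%R.
Proof.
move=> a; elim/elimq=> x; elim/elimq=> y.
by rewrite addE !piZ addE scalerDr.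
Qed.
Let scaleqDl c : {morph seminorm_quot_scale^~ c : a b / a + b}.
Proof.
by move=> a b; elim/elimq: c => x; rewrite !piZ addE scalerDl.
Qed.

HB.instance Definition _ := GRing.Zmodule_isLmodule.Build R seminorm_quot
  scaleqA scale1q scaleqDr scaleqDl.

Let qnormD (c d : seminorm_quot) :
  seminorm_quot_norm (c + d) <= seminorm_quot_norm c + seminorm_quot_norm d.
Proof.
elim/elimq: c => x; elim/elimq: d => y.
rewrite addE !pi_norm.
exact: seminorm_triangle.
Qed.
Let qnormZ (a : R) (c : seminorm_quot) :
  seminorm_quot_norm (a *: c) = `|a| * seminorm_quot_norm c.
Proof.
elim/elimq: c => x; rewrite [X in seminorm_quot_norm X](piZ a x) !pi_norm.
exact: seminorm_scale.
Qed.
Let qnorm_eq0 (c : seminorm_quot) : seminorm_quot_norm c = 0 -> c = 0.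
Proof.
elim/elimq: c => x; rewrite pi_norm => x0.
by apply/seminorm_piP; rewrite subr0.
Qed.

HB.instance Definition _ :=
  Lmodule_isNormed.Build R seminorm_quot qnormD qnormZ qnorm_eq0.

Lemma seminorm_pi_norm x : `|seminorm_pi x| = N x.
Proof. exact: pi_norm. Qed.

Lemma seminorm_pi_linear : linear seminorm_pi.
Proof.
move=> a x y; rewrite -addE; congr (_ + _); symmetry; exact: piZ.
Qed.

Lemma seminorm_pi_surj (c : seminorm_quot) : exists x, seminorm_pi x = c.
Proof. by exists (rep c). Qed.

End SeminormQuotient.

Section Completion.
Context {R : realType} (V : normedModType R).

Definition cauchy_pred : {pred (nat -> V)} := fun u => `[< cauchy (u @ \oo) >].

Record cauchy_sequence := CauchySequence {
  cs_fun :> nat -> V ;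
  cs_subproof : cs_fun \in cauchy_pred }.

HB.instance Definition _ := [isSub for cs_fun].
HB.instance Definition _ := [Choice of cauchy_sequence by <:].

Lemma cauchy_seqP (u : nat -> V) : cauchy (u @ \oo) <->
  forall e : R, 0 < e ->
    exists n, forall i j, (n <= i)%N -> (n <= j)%N -> `|u i - u j| < e.
Proof.
split=> [/cauchy_ballP cu e e0|cu].
  have [[A B] /= [[n _ nA] [m _ mB]] AB] := cu _ e0.
  exists (maxn n m) => i j; rewrite !geq_max => /andP[ni mi] /andP[nj mj].
  have := AB (u i, u j); rewrite -ball_normE /=; apply; split => /=.
    exact: nA.
  exact: mB.
apply/cauchy_exP => e e0; have [n nu] := cu _ e0.
exists (u n); exists n => // i /= ni; rewrite -ball_normE /=.
exact: nu.
Qed.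

Lemma cauchy_submod_closed : submod_closed cauchy_pred.
Proof.
split.
  apply/asboolP; apply: (cauchy_seqP _).2 => e e0; exists 0%N => i j _ _.
  by rewrite subrr normr0.
move=> a u v /asboolP/(cauchy_seqP _).1 cu /asboolP/(cauchy_seqP _).1 cv.
apply/asboolP; apply: (cauchy_seqP _).2 => e e0.
have d0 : 0 < e / 2 / (`|a| + 1) by rewrite !divr_gt0 // ltr_wpDl.
have [n nu] := cu _ d0; have [m mv] := cv _ (divr_gt0 e0 (@ltr0Sn _ 1)).
exists (maxn n m) => i j; rewrite !geq_max => /andP[ni mi] /andP[nj mj].
rewrite !fctE opprD addrACA -scalerBr (le_lt_trans (ler_normD _ _)) //.
rewrite [ltRHS]splitr ler_ltD //; last exact: mv.
rewrite normrZ; have := ltW (nu _ _ ni nj); rewrite ler_pdivlMr ?ltr_wpDl //.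
apply: le_trans; rewrite mulrC ler_wpM2l // lerDl.
exact: ler01.
Qed.

HB.instance Definition _ :=
  GRing.isSubmodClosed.Build R (nat -> V) cauchy_pred cauchy_submod_closed.
HB.instance Definition _ :=
  [SubChoice_isSubLmodule of cauchy_sequence by <:].

Lemma csP (u : cauchy_sequence) (e : R) : 0 < e ->
  exists n, forall i j, (n <= i)%N -> (n <= j)%N -> `|u i - u j| < e.
Proof. by apply: (cauchy_seqP _).1; case: u => u /= /asboolP. Qed.

Definition cauchy_norm (u : cauchy_sequence) : R := limn (fun n => `|u n|).

Lemma cauchy_norm_cvg (u : cauchy_sequence) :
  (fun n => `|u n|) @ \oo --> cauchy_norm u.
Proof.
apply/cauchy_cvgP/cauchy_exP => e e0; have [n nu] := csP u e0.
exists `|u n|; exists n => // i /= ni; rewrite -ball_normE /=.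
by rewrite (le_lt_trans (ler_dist_dist _ _)) // nu.
Qed.

Lemma cauchy_norm_seminorm : is_seminorm cauchy_norm.
Proof.
split=> [u v|a u].
  apply: (ler_cvg_to (@cauchy_norm_cvg (u + v))
    (cvgD (@cauchy_norm_cvg u) (@cauchy_norm_cvg v))).
  by apply: nearW => n; exact: ler_normD.
apply: (@cvg_unique _ _ ((fun n => `|(a *: u) n|) @ \oo)) => //.
  exact: cauchy_norm_cvg.
rewrite (_ : (fun n => _) = (fun n => `|a| * `|u n|)).
  by apply: cvgMr; exact: cauchy_norm_cvg.
by apply/funext => n; rewrite -normrZ.
Qed.

(* Cauchy sequences modulo null sequences, with norm lim |u n|. *)
Definition completion : Type := seminorm_quot cauchy_norm_seminorm.
HB.instance Definition _ := NormedModule.on completion.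

Let cst_cauchy (x : V) : (fun=> x) \in cauchy_pred.
Proof.
apply/asboolP; apply: (cauchy_seqP _).2 => e e0; exists 0%N => i j _ _.
by rewrite subrr normr0.
Qed.

Definition completion_in (x : V) : completion :=
  seminorm_pi cauchy_norm_seminorm (CauchySequence (cst_cauchy x)).

Lemma completion_in_linear : linear completion_in.
Proof.
move=> a x y; rewrite /completion_in -seminorm_pi_linear.
by congr seminorm_pi; apply: val_inj.
Qed.

Lemma completion_in_norm (x : V) : `|completion_in x| = `|x|.
Proof.
rewrite seminorm_pi_norm.
apply: (@cvg_unique _ _ ((fun=> `|x|) @ \oo)) => //.
  exact: cauchy_norm_cvg.
exact: cvg_cst.
Qed.

Let approx (u : cauchy_sequence) (e : R) : 0 < e -> \forall n \near \oo,
  `|seminorm_pi cauchy_norm_seminorm u - completion_in (u n)| <= e.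
Proof.
move=> e0; have [n nu] := csP u e0; exists n => // i /= ni.
rewrite -scaleN1r addrC -seminorm_pi_linear seminorm_pi_norm.
apply: (ler_cvg_to
  (@cauchy_norm_cvg (-1 *: CauchySequence (cst_cauchy (u i)) + u)) (cvg_cst e)).
exists n => // k /= nk; rewrite [X in `|X|](_ : _ = - u i + u k).
  by rewrite addrC ltW // nu.
by congr (_ + _); rewrite -[LHS]/(-1 *: u i) scaleN1r.
Qed.

Lemma completion_in_dense (c : completion) (e : R) : 0 < e ->
  exists x, `|c - completion_in x| < e.
Proof.
move=> e0; have [u <-] := seminorm_pi_surj c.
have [n _ /(_ n (leqnn n))] := approx u (divr_gt0 e0 (@ltr0Sn _ 1)).
move=> /= un; exists (u n); rewrite (le_lt_trans un) //.
by rewrite ltr_pdivrMr // ltr_pMr // ltr1n.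
Qed.

Let completion_inB x y : completion_in (x - y) = completion_in x - completion_in y.
Proof.
rewrite -[in RHS]scaleN1r [RHS]addrC -completion_in_linear.
by rewrite scaleN1r addrC.
Qed.

Lemma completion_complete (F : set_system completion) :
  ProperFilter F -> cauchy F -> cvg F.
Proof.
move=> PF /cauchyP cF.
have inv_gt0 n : 0 < n.+1%:R^-1 :> R by rewrite invr_gt0.
have /choice[x Fx] n : exists x : V, F (ball (completion_in x) n.+1%:R^-1).
  have h0 : 0 < n.+1%:R^-1 / 2 :> R by rewrite divr_gt0.
  have [c Fc] := cF _ h0; have [x cx] := completion_in_dense c h0.
  exists x; apply: filterS Fc => d; rewrite -!ball_normE /= => cd.
  rewrite [ltRHS]splitr -(subrKA c) (le_lt_trans (ler_normD _ _)) //.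
  by rewrite ltrD // distrC.
have invS (e : R) : 0 < e -> exists n, forall i, (n <= i)%N -> i.+1%:R^-1 < e.
  move=> e0; have := @cvg_harmonic R => /cvgrPdist_lt/(_ e e0)[n _ nP].
  exists n => i /nP /=; rewrite sub0r normrN ger0_norm //.
have cx : cauchy (x @ \oo).
  apply: (cauchy_seqP _).2 => e e0; have [n nP] := invS _ (divr_gt0 e0 (@ltr0Sn _ 1)).
  exists n => i j ni nj.
  have /filter_ex[d [di dj]] : F (ball (completion_in (x i)) i.+1%:R^-1 `&`
      ball (completion_in (x j)) j.+1%:R^-1) by apply: filterI.
  rewrite -completion_in_norm completion_inB -(subrKA d).
  rewrite (le_lt_trans (ler_normD _ _)) // [ltRHS]splitr.
  move: di dj; rewrite -!ball_normE /= => di dj.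
  by rewrite ltrD // ?(lt_trans di) ?nP // distrC (lt_trans dj) // nP.
have xP : x \in cauchy_pred by apply/asboolP.
pose c : completion := seminorm_pi cauchy_norm_seminorm (CauchySequence xP).
apply/cvg_ex; exists c; apply/cvgrPdist_lt => e e0.
have h0 := divr_gt0 e0 (@ltr0Sn R 1).
have [n nP] := invS _ h0.
have [m _ mP] := approx (CauchySequence xP) (divr_gt0 h0 (@ltr0Sn R 1)).
pose k := maxn n m.
have kP : `|c - completion_in (x k)| < e / 2.
  rewrite (le_lt_trans (mP k _)) //= ?leq_maxr //.
  by rewrite ltr_pdivrMr // ltr_pMr // ltr1n.
apply: filterS (Fx k) => d; rewrite -ball_normE /= => kd.
rewrite -(subrKA (completion_in (x k))) (le_lt_trans (ler_normD _ _)) //.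
by rewrite [ltRHS]splitr ltrD // (lt_trans kd) // nP // leq_maxl.
Qed.

HB.instance Definition _ :=
  Uniform_isComplete.Build completion completion_complete.

End Completion.

Section Cones.
Context {R : realType}.

(* [0 \in K] is part of the definition: it excludes the empty set, which is
   not meant to be a cone. *)
Record is_cone (V : lmodType R) (K : set V) : Prop := IsCone {
  cone0 : K 0 ;
  coneD : forall x y, K x -> K y -> K (x + y) ;
  coneZ : forall (a : R) x, 0 <= a -> K x -> K (a *: x) }.

(* The pre-order of a cone: x <= y iff [K (y - x)]. *)
Definition cone_le (V : lmodType R) (K : set V) (x y : V) : Prop := K (y - x).

Definition proper_cone (V : lmodType R) (K : set V) : Prop :=
  K `&` [set x | K (- x)] = [set 0].

Definition cone_differences (V : lmodType R) (K : set V) : set V :=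
  [set x | exists y z, [/\ K y, K z & x = y - z]].

Definition generating (V : lmodType R) (K : set V) : Prop :=
  cone_differences K = setT.

Definition topologically_generating (V : normedModType R) (K : set V) : Prop :=
  closure (cone_differences K) = setT.

Definition normal_cone (V : normedModType R) (K : set V) (beta : R) : Prop :=
  forall x y, cone_le K 0 x -> cone_le K x y -> `|x| <= beta * `|y|.

Definition absolutely_normal_cone (V : normedModType R) (K : set V) (beta : R)
    : Prop :=
  forall x y, cone_le K x y -> cone_le K (- x) y -> `|x| <= beta * `|y|.

Definition positive_maps (X Y : normedModType R) (KX : set X) (KY : set Y)
    : set 'B(X, Y) :=
  [set T | forall x, KX x -> KY (T x)].

Definition completion_cone (V : normedModType R) (K : set V) :
  set (completion V) := closure (@completion_in R V @` K).

Definition is_Inv (X : normedModType R) (T : 'B(X, X)) : Prop :=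
  exists S : 'B(X, X), cancel T S /\ cancel S T.

Definition is_Inv_pos (X : normedModType R) (K : set X) (T : 'B(X, X)) : Prop :=
  exists S : 'B(X, X), [/\ cancel T S, cancel S T,
    positive_maps K K T & positive_maps K K S].

Record preordered_banach_algebra (A : completeNormedModType R)
    (mul : A -> A -> A) (K : set A) : Prop := PreorderedBanachAlgebra {
  alg_mulA : associative mul ;
  alg_linl : forall b, linear (mul^~ b) ;
  alg_linr : forall a, linear (mul a) ;
  alg_norm : forall a b, `|mul a b| <= `|a| * `|b| ;
  alg_cone : is_cone K ;
  alg_cone_mul : forall a b, K a -> K b -> K (mul a b) }.

Definition is_Aut_pos (A : normedModType R) (mul : A -> A -> A) (K : set A)
    (T : 'B(A, A)) : Prop :=
  {morph T : a b / mul a b} /\ is_Inv_pos K T.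

End Cones.

HB.mixin Record isTopologicalGroup G & Group G & PointedTopological G := {
  mulg_continuous : continuous (fun p : G * G => (p.1 * p.2)%g) ;
  invg_continuous : continuous (fun s : G => (s^-1)%g) }.

#[short(type="topologicalGroupType")]
HB.structure Definition TopologicalGroup :=
  {G of isTopologicalGroup G & Group G & PointedTopological G}.

Definition locally_compact_group (G : topologicalGroupType) : Prop :=
  hausdorff_space G /\ locally_compact [set: G].

Notation borel G := (g_sigma_algebraType (@open G)).

Record left_haar_measure {R : realType} (G : topologicalGroupType)
    (mu : {measure set (borel G) -> \bar R}) : Prop := LeftHaarMeasure {
  haar_neq0 : mu setT <> 0%E ;
  haar_compact : forall K : set G, compact K -> (mu K < +oo)%E ;
  haar_outer : forall B : set (borel G), measurable B ->
    mu B = ereal_inf [set mu U | U in [set U : set G | open U /\ B `<=` U]] ;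
  haar_inner : forall U : set G, open U ->
    mu U = ereal_sup [set mu K | K in [set K : set G | compact K /\ K `<=` U]] ;
  haar_left : forall (s : G) (B : set (borel G)), measurable B ->
    mu [set (s * t)%g | t in B] = mu B }.

(* Defined by duality: y is the integral of f when phi y is the scalar integral
   of phi \o f for every phi in the dual of X.  For f continuous with compact
   support and X Banach, such a y exists and is unique. *)
Definition is_integral {R : realType} {G : topologicalGroupType}
    (mu : {measure set (borel G) -> \bar R}) {X : normedModType R}
    (f : G -> X) (y : X) : Prop :=
  forall phi : 'B(X, R^o),
    mu.-integrable setT (fun s : borel G => (phi (f s))%:E) /\
    phi y = \int[mu]_s phi (f s).

Section CompactSupport.
Context {R : realType} (G : topologicalType) (A : normedModType R).

Definition Cc_pred : {pred (G -> A)} := fun f =>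
  `[< continuous f /\ compact (closure [set s | f s != 0]) >].

Record Cc := MkCc {
  Cc_fun :> G -> A ;
  Cc_subproof : Cc_fun \in Cc_pred }.

HB.instance Definition _ := [isSub for Cc_fun].
HB.instance Definition _ := [Choice of Cc by <:].

Lemma Cc_submod_closed : submod_closed Cc_pred.
Proof.
split.
  apply/asboolP; split; first exact: cst_continuous.
  rewrite (_ : [set s | _] = set0) ?closure0; first exact: compact0.
  by rewrite -subset0 => s /=; rewrite eqxx.
move=> a f g /asboolP[cf kf] /asboolP[cg kg]; apply/asboolP; split.
  by move=> s; apply: cvgD; [apply: cvgZr; exact: cf|exact: cg].
apply: (subclosed_compact _ (compactU kf kg)); first exact: closed_closure.
rewrite -closureU; apply: closureS => s /=.
apply: contra_neqP => /not_orP[/negP + /negP]; rewrite !negbK => /eqP f0 /eqP g0.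
by rewrite !fctE f0 g0 scaler0 addr0.
Qed.

HB.instance Definition _ :=
  GRing.isSubmodClosed.Build R (G -> A) Cc_pred Cc_submod_closed.
HB.instance Definition _ := [SubChoice_isSubLmodule of Cc by <:].

Definition Cc_cone (K : set A) : set Cc := [set f : Cc | forall s, K (f s)].

End CompactSupport.

Section CrossedProduct.
Context {R : realType} {G : topologicalGroupType} {A : completeNormedModType R}.
Variables (mu : {measure set (borel G) -> \bar R}).
Variables (mul : A -> A -> A) (alpha : G -> 'B(A, A)).

Record dynamical_system (K : set A) : Prop := DynamicalSystem {
  dyn_group : locally_compact_group G ;
  dyn_algebra : preordered_banach_algebra mul K ;
  dyn_closed : closed K ;
  dyn_aut : forall s, is_Aut_pos mul K (alpha s) ;
  dyn_morph : forall s t a, alpha (s * t)%g a = alpha s (alpha t a) ;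
  dyn_continuous : forall a, continuous (fun s : G => alpha s a) }.

(* h = f * g.  The product is kept relational; that some h in C_c(G, A)
   satisfies this is a property of the system, not part of the definition. *)
Definition twisted_convolution (f g h : Cc G A) : Prop :=
  forall s, is_integral mu (fun r => mul (f r) (alpha r (g (r^-1 * s)%g))) (h s).

(* cov_U takes its values in Inv(X) and is multiplicative, hence a group
   homomorphism; in particular cov_U s^-1 is the inverse of cov_U s. *)
Record covariant_rep := CovariantRep {
  cov_space : completeNormedModType R ;
  cov_pi : 'B(A, 'B(cov_space, cov_space)) ;
  cov_U : G -> 'B(cov_space, cov_space) ;
  cov_pi_mul : forall a b x, cov_pi (mul a b) x = cov_pi a (cov_pi b x) ;
  cov_U_inv : forall s, is_Inv (cov_U s) ;
  cov_U_morph : forall s t x, cov_U (s * t)%g x = cov_U s (cov_U t x) ;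
  cov_U_continuous : forall x, continuous (fun s : G => cov_U s x) ;
  cov_covariant : forall s a x,
    cov_pi (alpha s a) x = cov_U s (cov_pi a (cov_U (s^-1)%g x)) }.

Definition positive_rep (K : set A) (rho : covariant_rep)
    (L : set (cov_space rho)) : Prop :=
  (forall a, K a -> positive_maps L L (cov_pi rho a)) /\
  (forall s, is_Inv_pos L (cov_U rho s)).

(* The operator x |-> \int pi (f r) (U r x) dr; it exists and is unique, so the
   default value 0 of xget is irrelevant. *)
Definition integrated_form (rho : covariant_rep) (f : Cc G A) :
    'B(cov_space rho, cov_space rho) :=
  xget 0 [set T : 'B(cov_space rho, cov_space rho) | forall x,
    is_integral mu (fun r => cov_pi rho (f r) (cov_U rho r x)) (T x)].

(* Classes of representations are predicates: covariant_rep lives in a universe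
   too large to be the argument of [set]. *)
Definition uniformly_bounded (C : covariant_rep -> Prop) : Prop :=
  (exists rho, C rho) /\ exists (M : R) (nu : G -> R),
  [/\ 0 <= M, (forall r, 0 <= nu r),
      (forall K : set G, compact K -> exists N, forall r, K r -> nu r <= N) &
      forall rho, C rho ->
        `|cov_pi rho| <= M /\ forall r, `|cov_U rho r| <= nu r].

Definition crossed_seminorm (C : covariant_rep -> Prop) (f : Cc G A) : R :=
  sup [set r | exists2 rho, C rho & r = `|integrated_form rho f|].

(* For a uniformly bounded class, crossed_seminorm is a (finite) seminorm.  The
   quotient and its completion take a proof HC of this as an argument; by proof
   irrelevance they do not depend on the choice of HC. *)
Section Completed.
Variables (C : covariant_rep -> Prop) (HC : is_seminorm (crossed_seminorm C)).

Definition crossed_quot : normedModType R := seminorm_quot HC.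
Definition crossed_q (f : Cc G A) : crossed_quot := seminorm_pi HC f.
Definition crossed_quot_cone (K : set A) : set crossed_quot :=
  crossed_q @` @Cc_cone R G A K.

Definition crossed_product : completeNormedModType R := completion crossed_quot.
Definition crossed_in (f : Cc G A) : crossed_product :=
  completion_in (crossed_q f).
Definition crossed_cone (K : set A) : set crossed_product :=
  completion_cone (crossed_quot_cone K).

End Completed.
End CrossedProduct.

Arguments crossed_quot {R G A mu mul alpha C} HC.
Arguments crossed_q {R G A mu mul alpha C} HC f.
Arguments crossed_quot_cone {R G A mu mul alpha C} HC K.
Arguments crossed_product {R G A mu mul alpha C} HC.
Arguments crossed_in {R G A mu mul alpha C} HC f.
Arguments crossed_cone {R G A mu mul alpha C} HC K.

(* Main.v *)
Require Import Defs.
From HB Require Import structures.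
From mathcomp Require Import all_boot all_order all_algebra.
From mathcomp Require Import all_classical all_reals all_analysis.
From mathcomp Require Import finmap lra measurable_realfun.

(** The whole argument takes place in the operator algebras of the spaces on which
the representations act.

Integrals of continuous compactly supported functions with values in a Banach
space are defined by duality. The Hahn-Banach theorem ([norming_functional])
makes them unique and bounds their norms; Riemann sums ([riemann_sum]) give
their existence and show that the integral of a function with values in a closed
cone lies in the cone ([is_integral_cone]). A Fubini theorem for continuous
functions with support in a product of compact sets
([fubini_compact_support]) and left invariance then show that the integrated
form turns twisted convolution into composition of operators
([integrated_form_multiplicative]), and that positive representations have
positive integrated forms.

The crossed seminorm is the supremum of the norms of the integrated forms, so
these descend to contractions of the quotient which together determine its norm.
The rest is a statement on such families ([extended_rep] and what follows it):
they extend to the completion, where they still determine the norm. The product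
of two elements is the element whose images are the composed operators, so
associativity, bilinearity and submultiplicativity are inherited from operators.
In the same way properness and (absolute) normality of the cone are inherited
from the cones of positive operators, because these are closed and contain the
images of the positive elements.

The difference statements are about density. When [Apos] is generating, a
function with compact support is uniformly close to a finite sum of the form
[\sum_x theta x *: f x] with a partition of unity [theta]
([tensor_approximation]), and each value [f x] is a difference of positive
elements. When the quotient has a dominating map that preserves Cauchy
sequences, the limit of the dominating elements dominates the limit
([completion_cone_generating]). *)

Set Implicit Arguments.
Unset Strict Implicit.
Unset Printing Implicit Defensive.

Import Order.TTheory GRing.Theory Num.Theory.
Import numFieldNormedType.Exports.

Local Open Scope classical_set_scope.
Local Open Scope ring_scope.

(** * Hahn-Banach theorem *)

Section HahnBanach.
Context {R : realType} {X : normedModType R}.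
Implicit Types (q : X -> R) (x y : X).

Definition sublinear q :=
  (forall x y, q (x + y) <= q x + q y) /\
  (forall (a : R) x, 0 <= a -> q (a *: x) = a * q x).

Lemma sublinear_ge q x y : sublinear q -> q y - q (- x) <= q (x + y).
Proof.
move=> [qD _]; rewrite lerBlDr.
by have := qD (x + y) (- x); rewrite addrC addKr.
Qed.

Lemma sublinear_at0 q : sublinear q -> q 0 = 0.
Proof. by move=> [_ /(_ 0 0 (lexx 0))]; rewrite scale0r mul0r. Qed.

(** The infimum of these values, as a function of [x], is [q] lowered along the ray
through [y]: the term for [t = 1] shows that its value at [- y] is at most
[- q y]. *)
Let shifts q y x := [set q (x + t *: y) - t * q y | t in [set t | 0 <= t]].
Let reduct q y x : R := inf (shifts q y x).

Let shifts_lbound q y x : sublinear q -> lbound (shifts q y x) (- q (- x)).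
Proof.
move=> sq _ [t /= t0 <-]; rewrite lerBrDr addrC.
by rewrite -(sq.2 _ _ t0); exact: sublinear_ge.
Qed.

Let shifts_has_inf q y x : sublinear q -> has_inf (shifts q y x).
Proof.
move=> sq; split; last by exists (- q (- x)); exact: shifts_lbound.
by exists (q (x + 0 *: y) - 0 * q y); exists 0 => /=.
Qed.

Let reduct_le q y x t : sublinear q -> 0 <= t ->
  reduct q y x <= q (x + t *: y) - t * q y.
Proof.
by move=> sq t0; apply: ge_inf; [exact: (shifts_has_inf y x sq).2|exists t].
Qed.

Let reduct_sublinear q y : sublinear q -> sublinear (reduct q y).
Proof.
move=> sq; have [qD qZ] := sq; split=> [u v|a x].
  rewrite -lerBlDr; apply: lb_le_inf; first exact: (shifts_has_inf y u sq).1.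
  move=> _ [s /= s0 <-]; rewrite lerBlDl -lerBlDr.
  apply: lb_le_inf; first exact: (shifts_has_inf y v sq).1.
  move=> _ [t /= t0 <-].
  have := qD (u + s *: y) (v + t *: y).
  have := reduct_le y (u + v) sq (addr_ge0 s0 t0).
  by rewrite scalerDl addrACA; lra.
rewrite le_eqVlt => /predU1P[<-|a0].
  rewrite scale0r mul0r /reduct (_ : shifts _ _ _ = [set 0]) ?inf1 //.
  apply/seteqP; split=> [_ [t /= t0 <-]|_ ->].
    by rewrite add0r qZ // subrr.
  by exists 0 => //=; rewrite scale0r addr0 sublinear_at0 // mul0r subrr.
have step b u : 0 < b -> reduct q y (b *: u) <= b * reduct q y u.
  move=> b0; rewrite -ler_pdivrMl //.
  apply: lb_le_inf; first exact: (shifts_has_inf y u sq).1.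
  move=> _ [t /= t0 <-]; rewrite ler_pdivrMl //.
  rewrite (le_trans (reduct_le y (b *: u) sq (mulr_ge0 (ltW b0) t0))) //.
  by rewrite -scalerA -scalerDr (qZ _ _ (ltW b0)) mulrBr mulrA.
apply/eqP; rewrite eq_le step //=.
have ai : 0 < a^-1 by rewrite invr_gt0.
have := step a^-1 (a *: x) ai.
by rewrite scalerA mulVf ?gt_eqF // scale1r ler_pdivlMl.
Qed.

(** Lowering [q] along the ray through [y] gives a sublinear functional, which
cannot lie strictly below a minimal [q]; that it equals [q] says that [q] is
additive in the direction [y]. *)
Lemma minimal_sublinear_additive q : sublinear q ->
  (forall p, sublinear p -> (forall x, p x <= q x) -> forall x, q x <= p x) ->
  forall x y, q (x + y) = q x + q y.
Proof.
move=> sq qmin x y; apply/eqP; rewrite eq_le sq.1 /=.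
have le_q z : reduct q y z <= q z.
  by rewrite (le_trans (reduct_le y z sq (lexx 0))) // scale0r addr0 mul0r subr0.
have := qmin _ (reduct_sublinear y sq) le_q x.
move=> /le_trans/(_ (reduct_le y x sq ler01)).
by rewrite scale1r mul1r lerBrDr.
Qed.

(** A minimal sublinear functional below [q] is linear. Zorn's lemma provides
one, since the infimum of a chain of sublinear functionals is sublinear. *)
Lemma linear_below_sublinear q : sublinear q ->
  exists phi : X -> R, linear phi /\ forall x, phi x <= q x.
Proof.
move=> sq.
pose T := {p : X -> R | sublinear p /\ forall x, p x <= q x}.
pose r : rel T := fun p p' => `[< forall x, sval p' x <= sval p x >].
have q0 : T by exists q.
have [||A totA|[p [sp pq]] pmin] := @ZL_preorder T q0 r.
- by move=> p; apply/asboolP.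
- move=> p1 p2 p3 /asboolP h1 /asboolP h2; apply/asboolP => x.
  exact: le_trans (h2 x) (h1 x).
- have [[p0 Ap0]|nA] := pselect (exists p, A p); last first.
    by exists q0 => s As; exfalso; apply: nA; exists s.
  pose vals x := [set sval s x | s in A].
  have hi x : has_inf (vals x).
    split; first by exists (sval p0 x); exists p0.
    exists (- q (- x)) => _ [p Ap <-].
    have [sp pq] := svalP p.
    have /= := sublinear_ge x 0 sp; rewrite addr0.
    rewrite (sublinear_at0 sp) sub0r.
    by apply: le_trans; rewrite lerN2.
  have inf_le x p : A p -> inf (vals x) <= sval p x.
    by move=> Ap; apply: ge_inf; [exact: (hi x).2|exists p].
  have sinf : sublinear (fun x => inf (vals x)).
    split=> [x y|a x].
      rewrite -lerBlDr; apply: lb_le_inf; first exact: (hi x).1.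
      move=> _ [p Ap <-]; rewrite lerBlDl -lerBlDr.
      apply: lb_le_inf; first exact: (hi y).1.
      move=> _ [p' Ap' <-]; rewrite lerBlDr.
      have [/asboolP pp'|/asboolP p'p] := totA _ _ Ap Ap'.
        rewrite (le_trans (inf_le _ _ Ap')) // (le_trans ((svalP p').1.1 _ _)) //.
        by rewrite addrC lerD2l.
      rewrite (le_trans (inf_le _ _ Ap)) // (le_trans ((svalP p).1.1 _ _)) //.
      by rewrite addrC lerD2r.
    rewrite le_eqVlt => /predU1P[<-|a0].
      rewrite scale0r mul0r (_ : vals 0 = [set 0]) ?inf1 //.
      apply/seteqP; split=> [_ [p Ap <-]|_ ->].
        by rewrite (sublinear_at0 (svalP p).1).
      exists p0 => //.
      by rewrite (sublinear_at0 (svalP p0).1).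
    apply/eqP; rewrite eq_le; apply/andP; split.
      rewrite -ler_pdivrMl //; apply: lb_le_inf; first exact: (hi x).1.
      move=> _ [p Ap <-]; rewrite ler_pdivrMl //.
      by rewrite -((svalP p).1.2 _ _ (ltW a0)); exact: inf_le.
    apply: lb_le_inf; first exact: (hi _).1.
    move=> _ [p Ap <-]; rewrite ((svalP p).1.2 _ _ (ltW a0)) ler_pM2l //.
    exact: inf_le.
  have infq x : inf (vals x) <= q x.
    by rewrite (le_trans (inf_le x _ Ap0)) //; exact: (svalP p0).2.
  exists (exist _ (fun x => inf (vals x)) (conj sinf infq)) => s As.
  by apply/asboolP => x; exact: inf_le.
exists p; split=> //.
have pD : forall x y, p (x + y) = p x + p y.
  apply: (minimal_sublinear_additive sp) => p' sp' p'p.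
  have p'q x : p' x <= q x by rewrite (le_trans (p'p x)).
  have := pmin (exist _ p' (conj sp' p'q)).
  by move=> /(_ _)/asboolP; apply; apply/asboolP.
have p0 := sublinear_at0 sp.
have pN x : p (- x) = - p x.
  by apply/eqP; rewrite -addr_eq0 -pD addNr p0.
move=> a x y; rewrite pD; congr (_ + _).
have [a0|a0] := leP 0 a; first exact: sp.2.
have na0 : 0 <= - a by rewrite oppr_ge0 ltW.
have -> : a *: x = - ((- a) *: x) by rewrite scaleNr opprK.
by rewrite pN (sp.2 _ _ na0) mulNr opprK.
Qed.

(** The norm, lowered along the ray through [y], is at most [- `|y|] at [- y]; a
linear functional below it stays below the norm and attains it at [y]. *)
Theorem norming_functional y : exists phi : 'B(X, R^o),
  (forall x, `|phi x| <= `|x|) /\ phi y = `|y|.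
Proof.
have sn : sublinear (fun x : X => `|x|).
  split=> [u v|a u a0]; first exact: ler_normD.
  by rewrite normrZ ger0_norm.
have [phi [lphi phile]] := linear_below_sublinear (reduct_sublinear y sn).
have le_n x : phi x <= `|x|.
  rewrite (le_trans (phile x)) // (le_trans (reduct_le y x sn (lexx 0))) //.
  by rewrite scale0r addr0 mul0r subr0.
have phi0 : phi 0 = 0.
  by have := lphi (-1) 0 0; rewrite scaler0 addr0 scaleN1r addNr.
have phiN x : phi (- x) = - phi x.
  by have := lphi (-1) x 0; rewrite !addr0 phi0 addr0 !scaleN1r.
have bphi : (phi : X -> R^o) \in bl_pred (X := X) (Y := R^o).
  apply/asboolP; split; first exact: lphi.
  exists 1 => x; rewrite mul1r ler_norml le_n andbT.
  by rewrite lerNl -phiN (le_trans (le_n _)) // normrN.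
exists (BoundedLinear bphi); split=> [x|] /=.
  rewrite ler_norml le_n andbT.
  by rewrite lerNl -phiN (le_trans (le_n _)) // normrN.
apply/eqP; rewrite eq_le le_n /= -lerN2 -phiN (le_trans (phile _)) //.
rewrite (le_trans (reduct_le y (- y) sn ler01)) //.
by rewrite scale1r addNr normr0 mul1r sub0r.
Qed.

End HahnBanach.

(** * Riemann sums for a Borel measure finite on compact sets *)

Lemma compact_finite_net (T : ptopologicalType) (K : set T) (V : T -> set T) :
  compact K -> (forall s, K s -> nbhs s (V s)) ->
  exists2 l : seq T, (forall x, x \in l -> K x) &
    forall t, K t -> exists2 x, x \in l & (interior (V x)) t.
Proof.
rewrite compact_cover => Kco KV.
have [|s Ks|D DK Kcov] := Kco T K (fun s => interior (V s)).
- by move=> s _; exact: open_interior.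
- by exists s => //; exact: KV.
exists (enum_fset D) => [x xD|t Kt].
  by apply/set_mem; exact: DK.
by have [x xD xt] := Kcov t Kt; exists x.
Qed.

Section CompactlySupportedIntegral.
Context {R : realType} {G : topologicalGroupType}.
Variable mu : {measure set (borel G) -> \bar R}.
Hypothesis hausG : hausdorff_space G.
Hypothesis mu_compact : forall K : set G, compact K -> (mu K < +oo)%E.

Lemma borel_open (U : set G) : open U -> measurable (U : set (borel G)).
Proof. by move=> oU; exact: sub_sigma_algebra. Qed.

Lemma borel_compact (K : set G) : compact K -> measurable (K : set (borel G)).
Proof.
move=> /(compact_closed hausG) cK; rewrite -(setCK K).
by apply: measurableC; apply: borel_open; rewrite openC.
Qed.

Lemma borel_continuous (g : G -> R) : continuous g ->
  measurable_fun setT (g : borel G -> R).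
Proof.
move=> /continuousP cg; apply: (measurability _ (RGenOpens.measurableE R)).
move=> _ [_ [a [b ->] <-]]; rewrite setTI; apply: borel_open.
exact/cg/interval_open.
Qed.

Let vol (K : set G) : R := fine (mu K).

Lemma integrable_bounded (B : set (borel G)) (g : G -> R) (c : R) :
  measurable B -> (mu B < +oo)%E -> measurable_fun setT (g : borel G -> R) ->
  (forall t, B t -> `|g t| <= c) -> mu.-integrable B (EFin \o g).
Proof.
move=> mB Boo mg gc; apply: measurable_bounded_integrable => //.
  exact: measurable_funTS.
exists c; split; first exact: num_real.
by move=> x cx t Bt /=; rewrite (le_trans (gc t Bt)) // ltW.
Qed.

Lemma Rintegral_support (B : set (borel G)) (g : G -> R) :
  (forall t, ~ B t -> g t = 0) -> \int[mu]_t g t = \int[mu]_(t in B) g t.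
Proof.
move=> g0; rewrite [RHS]Rintegral_mkcond; congr Rintegral.
apply/funext => t; rewrite patchE; case: ifPn => // /negP nB.
by apply: g0 => Bt; apply: nB; exact/mem_set.
Qed.

Lemma integrable_support (B : set (borel G)) (g : G -> R) : measurable B ->
  (forall t, ~ B t -> g t = 0) ->
  mu.-integrable B (EFin \o g) -> mu.-integrable setT (EFin \o g).
Proof.
move=> mB g0 /(integrable_mkcond _ mB); congr (integrable _ _ _).
apply/funext => t; rewrite patchE; case: ifPn => // /negP nB.
by rewrite /= g0 // => Bt; apply: nB; exact/mem_set.
Qed.

Lemma Rintegral_norm_le (B : set (borel G)) (g : G -> R) (c : R) :
  measurable B -> (mu B < +oo)%E -> mu.-integrable B (EFin \o g) ->
  (forall t, B t -> `|g t| <= c) -> `|\int[mu]_(t in B) g t| <= c * vol B.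
Proof.
move=> mB Boo ig gc; rewrite (le_trans (le_normr_Rintegral mB ig)) //.
rewrite -(Rintegral_cst mu mB c); apply: le_Rintegral => //.
  exact: integrable_norm.
apply/integrableP; split; first exact: measurable_cst.
rewrite integral_cst // lte_mul_pinfty // ?ge0_fin_numE //.
Qed.


(** Cutting [B] along the cover by the [V x], one set after the other, replaces
an integral over [B] by a finite sum of values. The pairs in [ws] consist of a
weight, the measure of a piece, and a sample point; they are chosen before the
integrand, which only has to oscillate little on each [V x]. *)
Lemma riemann_sum_cover (V : G -> set G) (l : seq G) (B : set (borel G)) :
  (forall x, open (V x)) -> measurable B -> (mu B < +oo)%E ->
  (forall t, B t -> exists2 x, x \in l & V x t) ->
  exists ws : seq (R * G),
  [/\ forall p, p \in ws -> 0 <= p.1 /\ p.2 \in l,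
      \sum_(p <- ws) p.1 = fine (mu B) &
      forall (g : G -> R) (c : R), mu.-integrable B (EFin \o g) ->
        (forall x t, x \in l -> B t -> V x t -> `|g t - g x| <= c) ->
        `|\int[mu]_(t in B) g t - \sum_(p <- ws) p.1 * g p.2| <= c * fine (mu B)].
Proof.
move=> oV; elim: l B => [|x l IH] B mB Boo Bcov.
  have -> : B = set0 by rewrite -subset0 => t /Bcov[].
  exists [::]; split=> // [|g c _ _]; first by rewrite big_nil measure0.
  by rewrite big_nil Rintegral_set0 subr0 normr0 measure0 mulr0.
have mV : measurable (V x : set (borel G)) by exact: borel_open.
have mB1 : measurable (B `&` V x) by exact: measurableI.
have mB2 : measurable (B `\` V x) by exact: measurableD.
have B1oo : (mu (B `&` V x) < +oo)%E.
  by apply: le_lt_trans Boo; apply: le_measure; [exact/mem_set|exact/mem_set|exact: subIsetl].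
have B2oo : (mu (B `\` V x) < +oo)%E.
  by apply: le_lt_trans Boo; apply: le_measure; [exact/mem_set|exact/mem_set|exact: subDsetl].
have [|ws [wsl wsB wsE]] := IH _ mB2 B2oo.
  move=> t [Bt nV]; have [y] := Bcov t Bt.
  by rewrite inE => /predU1P[-> //|yl Vy]; exists y.
have BE : B = (B `&` V x) `|` (B `\` V x) by rewrite setUIDK.
have disj : [disjoint B `&` V x & B `\` V x].
  by apply/disj_setPS => t [[_ Vt] [_ nVt]].
have muB : fine (mu B) = fine (mu (B `&` V x)) + fine (mu (B `\` V x)).
  rewrite [in LHS]BE measureU //; last exact/disj_set2P.
  by rewrite fineD // ge0_fin_numE.
exists ((fine (mu (B `&` V x)), x) :: ws); split.
- move=> p; rewrite inE => /predU1P[->|/wsl[p0 pl]].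
    by split; rewrite ?mem_head //= fine_ge0.
  by split=> //; rewrite inE pl orbT.
- by rewrite big_cons wsB -muB.
move=> g c ig gc; rewrite big_cons /=.
have ig1 : mu.-integrable (B `&` V x) (EFin \o g).
  by apply: integrableS ig => //; exact: subIsetl.
have ig2 : mu.-integrable (B `\` V x) (EFin \o g).
  by apply: integrableS ig => //; exact: subDsetl.
have h2 : `|\int[mu]_(t in B `\` V x) g t - \sum_(p <- ws) p.1 * g p.2|
    <= c * fine (mu (B `\` V x)).
  by apply: wsE => // y t yl [Bt _]; apply: gc => //; rewrite inE yl orbT.
have h1 : `|\int[mu]_(t in B `&` V x) g t - fine (mu (B `&` V x)) * g x|
    <= c * fine (mu (B `&` V x)).
  have icst : mu.-integrable (B `&` V x) (EFin \o (fun=> g x)).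
    exact: (integrable_bounded (c := `|g x|)).
  rewrite mulrC -(Rintegral_cst mu mB1) -RintegralB //.
  apply: Rintegral_norm_le => //.
    by have := integrableB mB1 ig1 icst; congr (integrable _ _ _).
  by move=> t [Bt Vt]; apply: gc => //; rewrite mem_head.
have -> : \int[mu]_(t in B) g t =
    \int[mu]_(t in B `&` V x) g t + \int[mu]_(t in B `\` V x) g t.
  by rewrite -Rintegral_setU // -?BE.
rewrite opprD addrACA muB mulrDr (le_trans (ler_normD _ _)) //.
exact: lerD.
Qed.


(** One list of weights and sample points serves all integrands: all functionals of
a vector-valued function at once, and all sections of a function of two
variables at once. *)
Lemma riemann_sum (K : set G) (V : G -> set G) : compact K ->
  (forall s, K s -> nbhs s (V s)) ->
  exists ws : seq (R * G),
  [/\ forall p, p \in ws -> 0 <= p.1 /\ K p.2,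
      \sum_(p <- ws) p.1 = fine (mu K) &
      forall (g : G -> R) (c : R), mu.-integrable K (EFin \o g) ->
        (forall x t, K x -> K t -> V x t -> `|g t - g x| <= c) ->
        `|\int[mu]_(t in K) g t - \sum_(p <- ws) p.1 * g p.2| <= c * fine (mu K)].
Proof.
move=> cK KV; have [l lK lcov] := compact_finite_net cK KV.
have oV x : open (interior (V x)) by exact: open_interior.
have [ws [wsl wsK wsE]] :=
  riemann_sum_cover oV (borel_compact cK) (mu_compact cK) lcov.
exists ws; split=> // [p /wsl[p0 /lK]//|g c ig gc].
by apply: wsE => // x t /lK Kx Kt /interior_subset; exact: gc.
Qed.

Lemma continuous_compact_bounded (X : normedModType R) (K : set G) (f : G -> X) :
  compact K -> continuous f -> exists2 c, 0 <= c & forall s, K s -> `|f s| <= c.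
Proof.
move=> cK cf.
have /compact_bounded[M [_ MP]] : compact (f @` K).
  by apply: continuous_compact => //; exact: continuous_subspaceT.
exists (`|M| + 1) => [|s Ks]; first by rewrite addr_ge0.
by apply: MP; [rewrite (le_lt_trans (ler_norm M)) // ltrDl|exists s].
Qed.

Lemma integrable_continuous (K : set G) (g : G -> R) : compact K ->
  continuous g -> mu.-integrable K (EFin \o g).
Proof.
move=> cK cg; have [c _ gc] := continuous_compact_bounded (X := R^o) cK cg.
apply: (integrable_bounded (borel_compact cK) (mu_compact cK) _ gc).
exact: borel_continuous.
Qed.

End CompactlySupportedIntegral.

Section BoundedLinearMaps.
Context {R : realType}.
Implicit Types X Y Z : normedModType R.

HB.instance Definition _ X Y (T : 'B(X, Y)) :=
  GRing.isLinear.Build R X Y *:%R (T : X -> Y) (blP T).1.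

Lemma bl_continuous X Y (T : 'B(X, Y)) : continuous T.
Proof.
move=> x; apply/cvgrPdist_lt => e e0.
have d0 : 0 < opnorm T + 1 by rewrite ltr_wpDl ?opnorm_ge0.
apply/nbhs_normP; exists (e / (opnorm T + 1)) => [|y] /=; first exact: divr_gt0.
rewrite ltr_pdivlMr // mulrC -linearB; apply: le_lt_trans.
by rewrite (le_trans (le_opnorm T _)) // ler_wpM2r // lerDl.
Qed.

Lemma bl_norm_le X Y (T : 'B(X, Y)) x : `|T x| <= `|T| * `|x|.
Proof. exact: le_opnorm. Qed.

Lemma bl_norm_ub X Y (T : 'B(X, Y)) (c : R) : 0 <= c ->
  (forall x, `|T x| <= c * `|x|) -> `|T| <= c.
Proof.
move=> c0 Tc; apply: opnorm_le => x x1; rewrite (le_trans (Tc x)) //.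
by rewrite ler_piMr.
Qed.

Lemma bl_comp_subproof X Y Z (S : 'B(Y, Z)) (T : 'B(X, Y)) :
  (S \o T) \in bl_pred (X := X) (Y := Z).
Proof.
apply/asboolP; split=> [a x y|]; first by rewrite /= !linearP.
exists (opnorm S * opnorm T) => x /=.
by rewrite (le_trans (le_opnorm S _)) // -mulrA ler_wpM2l ?opnorm_ge0 ?le_opnorm.
Qed.

Definition bl_comp X Y Z (S : 'B(Y, Z)) (T : 'B(X, Y)) : 'B(X, Z) :=
  BoundedLinear (bl_comp_subproof S T).

End BoundedLinearMaps.

(** * Vector-valued integrals *)

Section VectorIntegral.
Context {R : realType} {G : topologicalGroupType}.
Variable mu : {measure set (borel G) -> \bar R}.
Hypothesis hausG : hausdorff_space G.
Hypothesis mu_compact : forall K : set G, compact K -> (mu K < +oo)%E.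

(** Since the integral is defined by duality, every estimate of it passes through
scalar integrals and this lemma. *)
Lemma dual_norm_le (X : normedModType R) (y : X) (c : R) :
  (forall phi : 'B(X, R^o), `|phi| <= 1 -> `|phi y| <= c) -> `|y| <= c.
Proof.
move=> yc; have [phi [phi1 phiy]] := norming_functional y.
have := yc phi; rewrite phiy normr_id; apply.
by apply: bl_norm_ub => // x; rewrite mul1r.
Qed.

Lemma functional_le (X : normedModType R) (phi : 'B(X, R^o)) (x : X) :
  `|phi| <= 1 -> `|phi x| <= `|x|.
Proof. by move=> phi1; rewrite (le_trans (bl_norm_le _ _)) // ler_piMl. Qed.

Lemma is_integral_unique (X : normedModType R) (f : G -> X) (y z : X) :
  is_integral mu f y -> is_integral mu f z -> y = z.
Proof.
move=> fy fz; apply/eqP; rewrite -subr_eq0 -normr_le0.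
apply: dual_norm_le => phi _.
by rewrite linearB /= (fy phi).2 (fz phi).2 subrr normr0.
Qed.

Lemma is_integralD (X : normedModType R) (f g : G -> X) (y z : X) :
  is_integral mu f y -> is_integral mu g z ->
  is_integral mu (fun s => f s + g s) (y + z).
Proof.
move=> fy gz phi; have [if_ fE] := fy phi; have [ig gE] := gz phi.
under [fun s : borel G => _]eq_fun do rewrite linearD EFinD.
split; first exact: integrableD.
rewrite linearD /= fE gE -RintegralD //.
by apply: eq_Rintegral => s _; rewrite linearD.
Qed.

Lemma is_integralZ (X : normedModType R) (a : R) (f : G -> X) (y : X) :
  is_integral mu f y -> is_integral mu (fun s => a *: f s) (a *: y).
Proof.
move=> fy phi; have E x : phi (a *: x) = (a *: phi) x by rewrite linearZ.
rewrite E; under eq_fun do rewrite E.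
by under eq_Rintegral do rewrite E; exact: fy.
Qed.

Lemma is_integral_norm_le (X : normedModType R) (K : set G) (f : G -> X) (y : X)
    (c : R) : compact K -> (forall s, ~ K s -> f s = 0) ->
  (forall s, K s -> `|f s| <= c) -> is_integral mu f y ->
  `|y| <= c * fine (mu K).
Proof.
move=> cK f0 fc fy; apply: dual_norm_le => phi phi1; rewrite (fy phi).2.
rewrite (Rintegral_support mu (B := K)); last by move=> t /f0 ->; rewrite linear0.
apply: Rintegral_norm_le => //; [exact: borel_compact|exact: mu_compact| |].
  by apply: integrableS (fy phi).1 => //; exact: borel_compact.
by move=> t Kt; rewrite (le_trans (functional_le _ phi1)) // fc.
Qed.

Lemma cone_sum (V : lmodType R) (L : set V) (I : eqType) (s : seq I)
    (F : I -> V) : is_cone L -> (forall i, i \in s -> L (F i)) ->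
  L (\sum_(i <- s) F i).
Proof.
move=> [L0 LD _] LF; rewrite big_seq.
by apply: (big_ind L) => // i /LF.
Qed.

(** The approximants are Riemann sums, which is why they lie in every cone that
contains the values of [f]. *)
Lemma riemann_approximation (X : normedModType R) (K : set G) (f : G -> X)
    (e : R) : compact K -> continuous f -> (forall s, ~ K s -> f s = 0) ->
  0 < e ->
  exists y : X,
  (forall L : set X, is_cone L -> (forall s, L (f s)) -> L y) /\
  forall phi : 'B(X, R^o), mu.-integrable setT (fun s : borel G => (phi (f s))%:E) /\
    `|\int[mu]_s phi (f s) - phi y| <= `|phi| * e.
Proof.
move=> cK cf f0 e0.
have d0 : 0 < e / (fine (mu K) + 1) by rewrite divr_gt0 // ltr_wpDl ?fine_ge0.
have [s Ks|ws [wsK wsE wsP]] :=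
    riemann_sum (V := fun s => [set t | `|f t - f s| < e / (fine (mu K) + 1)])
      hausG mu_compact cK.
  have := cf s; move=> /cvgr_distC_lt; exact.
exists (\sum_(p <- ws) p.1 *: f p.2); split=> [L cL Lf|phi].
  by apply: cone_sum => // p /wsK[p0 _]; case: cL => _ _; apply.
have cphi : continuous (fun s => phi (f s) : R).
  by move=> s; apply: continuous_comp; [exact: cf|exact: bl_continuous].
have phi0 s : ~ K s -> phi (f s) = 0 by move=> /f0 ->; rewrite linear0.
have iK := integrable_continuous hausG mu_compact cK cphi.
split; first exact: (integrable_support (borel_compact hausG cK) phi0 iK).
rewrite (Rintegral_support mu phi0) linear_sum /=.
under [X in _ - X]eq_bigr do rewrite linearZ.
apply: (le_trans (wsP _ (`|phi| * (e / (fine (mu K) + 1))) iK _)).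
  move=> x t _ _ /= xt; rewrite -linearB (le_trans (bl_norm_le phi _)) //.
  by rewrite ler_wpM2l // ltW.
rewrite -mulrA ler_wpM2l // mulrAC ler_pdivrMr ?ltr_wpDl ?fine_ge0 //.
by rewrite ler_wpM2l ?ltW // ltrDl.
Qed.

Lemma is_integral_approx (X : normedModType R) (K : set G) (f : G -> X) (y : X)
    (e : R) : compact K -> continuous f -> (forall s, ~ K s -> f s = 0) ->
  is_integral mu f y -> 0 < e ->
  exists z : X,
  (forall L : set X, is_cone L -> (forall s, L (f s)) -> L z) /\ `|y - z| <= e.
Proof.
move=> cK cf f0 fy e0; have [z [zL zP]] := riemann_approximation cK cf f0 e0.
exists z; split=> //; apply: dual_norm_le => phi phi1.
rewrite linearB /= (fy phi).2 (le_trans (zP phi).2) //.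
by rewrite ler_piMl // ltW.
Qed.

(** Riemann sums lie in the cone, and they approximate the integral in norm. *)
Lemma is_integral_cone (X : normedModType R) (K : set G) (f : G -> X) (y : X)
    (L : set X) : compact K -> continuous f -> (forall s, ~ K s -> f s = 0) ->
  is_integral mu f y -> is_cone L -> closed L -> (forall s, L (f s)) -> L y.
Proof.
move=> cK cf f0 fy coneL clL Lf; apply: clL => U /nbhs_normP[e /= e0 yU].
have e20 : 0 < e / 2 by rewrite divr_gt0.
have [z [zL yz]] := is_integral_approx cK cf f0 fy e20.
exists z; split; first exact: zL.
by apply: yU => /=; rewrite (le_lt_trans yz) // ltr_pdivrMr // ltr_pMr // ltr1n.
Qed.

(** Riemann sums for finer and finer covers form a Cauchy sequence: each of them is
close to the scalar integrals, uniformly over the functionals of norm at most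
one. *)
Lemma is_integral_exists (X : completeNormedModType R) (K : set G) (f : G -> X) :
  compact K -> continuous f -> (forall s, ~ K s -> f s = 0) ->
  exists y, is_integral mu f y.
Proof.
move=> cK cf f0.
have h0 n : 0 < n.+1%:R^-1 :> R by rewrite invr_gt0.
have /choice[y yP] : forall n, exists y : X, forall phi : 'B(X, R^o),
    mu.-integrable setT (fun s : borel G => (phi (f s))%:E) /\
    `|\int[mu]_s phi (f s) - phi y| <= `|phi| * n.+1%:R^-1.
  by move=> n; have [y [_ yP]] := riemann_approximation cK cf f0 (h0 n); exists y.
have invS (e : R) : 0 < e -> exists n, forall i, (n <= i)%N -> i.+1%:R^-1 < e.
  move=> e0; have := @cvg_harmonic R => /cvgrPdist_lt/(_ e e0)[n _ nP].
  exists n => i /nP /=; rewrite sub0r normrN ger0_norm //.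
have cy : cauchy (y @ \oo).
  apply: (cauchy_seqP _).2 => e e0; have [n nP] := invS _ (divr_gt0 e0 (@ltr0Sn _ 1)).
  exists n => i j ni nj.
  apply: (@le_lt_trans _ _ (i.+1%:R^-1 + j.+1%:R^-1)); last first.
    by rewrite [ltRHS]splitr ltrD ?nP.
  apply: dual_norm_le => phi phi1; rewrite linearB /=.
  rewrite -(subrKA (\int[mu]_s phi (f s))) (le_trans (ler_normD _ _)) // lerD //.
    by rewrite distrC (le_trans (yP i phi).2) // ler_piMl.
  by rewrite (le_trans (yP j phi).2) // ler_piMl.
have /cauchy_cvgP/cvg_ex[/= z yz] := cy.
exists z => phi; split; first exact: (yP 0%N phi).1.
have phiyz : (fun n => phi (y n) : R) @ \oo --> (phi z : R).
  by apply: continuous_cvg => //; exact: bl_continuous.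
apply: (cvg_unique _ phiyz); first exact: Rhausdorff.
apply/cvgrPdist_le => e e0.
have [n nP] := invS _ (divr_gt0 e0 (ltr_wpDl (normr_ge0 phi) ltr01)).
exists n => // i /= /nP/ltW ni; rewrite (le_trans (yP i phi).2) //.
rewrite (le_trans (ler_wpM2l (normr_ge0 _) ni)) // mulrCA ger_pMr //.
by rewrite ler_pdivrMr ?ltr_wpDl // mul1r lerDl.
Qed.

End VectorIntegral.

(** * Continuity in a parameter and Fubini's theorem *)

Lemma continuous_pair_l (T S Z : topologicalType) (F : T * S -> Z) (s : S) :
  continuous F -> continuous (fun t => F (t, s)).
Proof.
move=> cF t; apply: (@continuous_comp _ _ _ (fun t => (t, s)) F); last exact: cF.
by apply: cvg_pair => /=; [exact: cvg_id|exact: cvg_cst].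
Qed.

Lemma continuous_pair_r (T S Z : topologicalType) (F : T * S -> Z) (t : T) :
  continuous F -> continuous (fun s => F (t, s)).
Proof.
move=> cF s; apply: (@continuous_comp _ _ _ (fun s => (t, s)) F); last exact: cF.
by apply: cvg_pair => /=; [exact: cvg_cst|exact: cvg_id].
Qed.

(** Tube lemma: the neighborhoods of [s0] obtained around each point of [K] can be
replaced by a single one, as [K] is compact. *)
Lemma compact_uniform_continuity (R : realType) (T S : topologicalType)
    (X : normedModType R) (K : set T) (F : T * S -> X) (s0 : S) (e : R) :
  compact K -> continuous F -> 0 < e ->
  \forall s \near s0, forall t, K t -> `|F (t, s) - F (t, s0)| <= e.
Proof.
move=> /compact_near_coveringP cK cF e0; apply: cK => t Kt.
have e20 : 0 < e / 2 by rewrite divr_gt0.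
have near1 : \forall p \near (t, s0), `|F p - F (t, s0)| < e / 2.
  by have := cF (t, s0); move=> /cvgr_distC_lt/(_ _ e20).
have near2 : \forall t' \near t, `|F (t', s0) - F (t, s0)| < e / 2.
  by have := continuous_pair_l (s := s0) cF (x := t); move=> /cvgr_distC_lt/(_ _ e20).
have near2' : \forall p \near (t, s0), `|F (p.1, s0) - F (t, s0)| < e / 2.
  exact: (@cvg_fst _ _ (nbhs t) (nbhs s0)) _ near2.
move: near1 near2'; apply: filterS2 => -[t' s] /= h1 h2.
rewrite -(subrKA (F (t, s0))) (le_trans (ler_normD _ _)) //.
by rewrite [leRHS]splitr lerD ?ltW // distrC.
Qed.

Section Fubini.
Context {R : realType} {G : topologicalGroupType}.
Variable mu : {measure set (borel G) -> \bar R}.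
Hypothesis hausG : hausdorff_space G.
Hypothesis mu_compact : forall K : set G, compact K -> (mu K < +oo)%E.

(** The integrands for nearby parameters are uniformly close on [K], hence so are
their integrals. *)
Lemma is_integral_continuous (S : topologicalType) (X : normedModType R)
    (K : set G) (F : G * S -> X) (h : S -> X) : compact K -> continuous F ->
  (forall r s, ~ K r -> F (r, s) = 0) ->
  (forall s, is_integral mu (fun r => F (r, s)) (h s)) -> continuous h.
Proof.
move=> cK cF F0 Fh s0; apply/cvgrPdist_le => e e0.
have d0 : 0 < e / (fine (mu K) + 1) by rewrite divr_gt0 // ltr_wpDl ?fine_ge0.
have := compact_uniform_continuity s0 cK cF d0; apply: filterS => s sP.
rewrite distrC; have Fd : is_integral mu (fun r => F (r, s) - F (r, s0)) (h s - h s0).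
  have := is_integralD (Fh s) (is_integralZ (-1) (Fh s0)); rewrite scaleN1r.
  by under eq_fun do rewrite scaleN1r.
rewrite (le_trans (is_integral_norm_le hausG mu_compact cK _ sP Fd)) //.
  by move=> r nKr; rewrite !F0 // subrr.
by rewrite mulrAC ler_pdivrMr ?ltr_wpDl ?fine_ge0 // ler_wpM2l ?ltW // ltrDl.
Qed.

Lemma bl_id_subproof (X : normedModType R) : id \in bl_pred (X := X) (Y := X).
Proof. by apply/asboolP; split=> //; exists 1 => x; rewrite mul1r. Qed.

Lemma is_integral_scalar (K : set G) (g : G -> R^o) : compact K ->
  continuous g -> (forall s, ~ K s -> g s = 0) ->
  is_integral mu g (\int[mu]_s g s).
Proof.
move=> cK cg g0.
have [y gy] := is_integral_exists hausG mu_compact (X := R^o) cK cg g0.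
by have [_ <-] := gy (BoundedLinear (bl_id_subproof R^o)).
Qed.

Lemma Rintegral_linear_combination (B : set (borel G)) (I : Type)
    (ws : seq (R * I)) (F : I -> G -> R) : measurable B ->
  (forall i, mu.-integrable B (EFin \o F i)) ->
  mu.-integrable B (EFin \o (fun t => \sum_(p <- ws) p.1 * F p.2 t)) /\
  \int[mu]_(t in B) (\sum_(p <- ws) p.1 * F p.2 t) =
    \sum_(p <- ws) p.1 * \int[mu]_(t in B) F p.2 t.
Proof.
move=> mB iF; elim: ws => [|p ws [IHi IHE]].
  have -> : (fun t => \sum_(p <- [::]) p.1 * F p.2 t) = cst 0 :> (G -> R).
    by apply/funext => t; rewrite big_nil.
  by split; [exact: integrable0|rewrite big_nil Rintegral_cst // mul0r].
have ip : mu.-integrable B (EFin \o (fun t => p.1 * F p.2 t)).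
  by have := integrableZl mB p.1 (iF p.2); congr (integrable _ _ _).
have -> : (fun t => \sum_(q <- p :: ws) q.1 * F q.2 t) =
    (fun t => p.1 * F p.2 t + \sum_(q <- ws) q.1 * F q.2 t).
  by apply/funext => t; rewrite big_cons.
rewrite big_cons RintegralD // IHE RintegralZl //; split=> //.
by have := integrableD mB ip IHi; congr (integrable _ _ _).
Qed.

(** Two Riemann sums in place of a product measure: the Borel sets of [G * G]
need not be generated by rectangles. The first sum is uniform in the second
variable, so it may be integrated term by term. *)
Lemma fubini_compact_support (K1 K2 : set G) (F : G * G -> R^o) :
  compact K1 -> compact K2 -> continuous F ->
  (forall r s, ~ K1 r -> F (r, s) = 0) -> (forall r s, ~ K2 s -> F (r, s) = 0) ->
  \int[mu]_s (\int[mu]_r F (r, s)) = \int[mu]_r (\int[mu]_s F (r, s)).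
Proof.
move=> cK1 cK2 cF F1 F2.
pose F' (p : G * G) := F (p.2, p.1).
have cF' : continuous F'.
  move=> p; apply: (@continuous_comp _ _ _ (fun p : G * G => (p.2, p.1)) F).
    by apply: cvg_pair; [exact: cvg_snd|exact: cvg_fst].
  exact: cF.
pose g1 s : R^o := \int[mu]_r F (r, s); pose g2 r : R^o := \int[mu]_s F (r, s).
have int1 s : is_integral mu (fun r => F (r, s)) (g1 s).
  by apply: (is_integral_scalar cK1) => // [|r /F1//]; exact: continuous_pair_l.
have int2 r : is_integral mu (fun s => F (r, s)) (g2 r).
  by apply: (is_integral_scalar cK2) => // [|s /F2//]; exact: continuous_pair_r.
have cg1 : continuous g1 := is_integral_continuous cK1 cF F1 int1.
have cg2 : continuous g2.
  apply: (is_integral_continuous (F := F') cK2 cF' _ int2) => s r nKs.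
  exact: F2.
have g10 s : ~ K2 s -> g1 s = 0.
  move=> nK; rewrite /g1; under eq_Rintegral do rewrite F2 //.
  by rewrite Rintegral_cst // mul0r.
have g20 r : ~ K1 r -> g2 r = 0.
  move=> nK; rewrite /g2; under eq_Rintegral do rewrite F1 //.
  by rewrite Rintegral_cst // mul0r.
have m1 := borel_compact hausG cK1; have m2 := borel_compact hausG cK2.
pose v1 := fine (mu K1); pose v2 := fine (mu K2).
have v10 : 0 <= v1 by exact: fine_ge0.
have v20 : 0 <= v2 by exact: fine_ge0.
suff H e : 0 < e -> `|\int[mu]_s g1 s - \int[mu]_r g2 r| <= 2 * e * (v1 * v2).
  apply/eqP; rewrite -subr_eq0 -normr_le0; apply/ler_addgt0Pr => d d0.
  have w0 : 0 < 2 * (v1 * v2) + 1 by rewrite ltr_wpDl // !mulr_ge0.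
  pose q := d / (2 * (v1 * v2) + 1).
  have q0 : 0 < q by rewrite divr_gt0.
  have <- : q * (2 * (v1 * v2) + 1) = d by rewrite divfK // gt_eqF.
  by rewrite add0r (le_trans (H q q0)) //; lra.
move=> e0.
have [r Kr|ws [wsK wsE wsP]] := riemann_sum hausG mu_compact
    (V := fun r => [set r' | forall s, K2 s -> `|F (r', s) - F (r, s)| <= e]) cK1.
  by have := compact_uniform_continuity r cK2 cF' e0.
have i1 s : mu.-integrable K1 (EFin \o (fun r => F (r, s))).
  by apply: integrable_continuous => //; exact: continuous_pair_l.
have i2 r : mu.-integrable K2 (EFin \o (fun s => F (r, s))).
  by apply: integrable_continuous => //; exact: continuous_pair_r.
have ig1 : mu.-integrable K2 (EFin \o g1) by exact: integrable_continuous.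
have ig2 : mu.-integrable K1 (EFin \o g2) by exact: integrable_continuous.
pose S := \sum_(p <- ws) p.1 * g2 p.2.
have step1 : `|\int[mu]_(r in K1) g2 r - S| <= e * v2 * v1.
  apply: wsP => // r r' _ _ /= rr'; rewrite /g2.
  rewrite (Rintegral_support mu (F2 r')) (Rintegral_support mu (F2 r)).
  rewrite -RintegralB //; apply: Rintegral_norm_le => //; first exact: mu_compact.
  by have := integrableB m2 (i2 r') (i2 r); congr (integrable _ _ _).
have step2 : `|\int[mu]_(s in K2) g1 s - S| <= e * v1 * v2.
  have [iS SE] := Rintegral_linear_combination ws (F := fun r s => F (r, s)) m2 i2.
  have -> : S = \int[mu]_(s in K2) (\sum_(p <- ws) p.1 * F (p.2, s)).
    rewrite SE; apply: eq_bigr => p _; rewrite /g2.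
    by rewrite (Rintegral_support mu (F2 p.2)).
  rewrite -RintegralB //; apply: Rintegral_norm_le => //; first exact: mu_compact.
    by have := integrableB m2 ig1 iS; congr (integrable _ _ _).
  move=> s Ks; rewrite /g1 (Rintegral_support mu (fun r => @F1 r s)).
  by apply: wsP => // r r' _ _; apply.
rewrite (Rintegral_support mu g10) (Rintegral_support mu g20).
rewrite -(subrKA S) (le_trans (ler_normD _ _)) //.
rewrite [X in _ + X]distrC (le_trans (lerD step2 step1)) //; lra.
Qed.

End Fubini.

(** * Strongly continuous families and translations *)

Section StronglyContinuousFamilies.
Context {R : realType}.

(** Each orbit [s |-> B s x] is bounded on [K] by continuity; as [X] is complete,
the uniform boundedness principle bounds the norms. *)
Lemma strongly_continuous_bounded (T : topologicalType)
    (X : completeNormedModType R) (Y : normedModType R) (B : T -> 'B(X, Y))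
    (K : set T) : compact K -> (forall x, continuous (fun s => B s x)) ->
  exists2 c, 0 <= c & forall s, K s -> `|B s| <= c.
Proof.
move=> cK cB; pose F := [set (B s : X -> Y) | s in K].
have [|x|M MP] := @Banach_Steinhauss R X Y F _ _ 1.
- move=> _ [s Ks <-]; split; last exact: (blP (B s)).1.
  move=> r; exists (`|B s| * `|r|) => x xr; rewrite (le_trans (bl_norm_le _ _)) //.
  by rewrite ler_wpM2l // (le_trans xr) // ler_norm.
- have /compact_bounded[M [_ MP]] : compact ((fun s => B s x) @` K).
    by apply: continuous_compact => //; exact: continuous_subspaceT.
  exists (`|M| + 1) => _ [s Ks <-].
  by apply: MP; [rewrite (le_lt_trans (ler_norm M)) // ltrDl|exists s].
exists `|M| => // s Ks; apply: opnorm_le => x x1.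
by rewrite (le_trans (MP (B s) _ x x1)) ?ler_norm //; exists s.
Qed.

(** The increment splits as [B s (x - x0) + (B s - B s0) x0]; local boundedness
controls the first term, strong continuity the second. *)
Lemma strongly_continuous_joint (T : topologicalType) (X Y : normedModType R)
    (B : T -> 'B(X, Y)) : (forall x, continuous (fun s => B s x)) ->
  (forall s0 : T, exists c, \forall s \near s0, `|B s| <= c) ->
  continuous (fun p : T * X => B p.1 p.2).
Proof.
move=> cB lB [s0 x0]; have [c cP] := lB s0.
apply/cvgrPdistC_lt => e e0.
have d0 : 0 < e / 2 / (`|c| + 1) by rewrite !divr_gt0 // ltr_wpDl.
have near1 : \forall s \near s0, `|B s x0 - B s0 x0| < e / 2.
  by have := cB x0 s0; move=> /cvgr_distC_lt; apply; rewrite divr_gt0.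
have near2 : \forall x \near x0, `|x0 - x| < e / 2 / (`|c| + 1).
  by apply/nbhs_normP; exists (e / 2 / (`|c| + 1)).
have n1 : \forall p \near (s0, x0), `|B p.1| <= c /\ `|B p.1 x0 - B s0 x0| < e / 2.
  exact: (@cvg_fst _ _ (nbhs s0) (nbhs x0) _) _ (filterI cP near1).
have n2 : \forall p \near (s0, x0), `|x0 - p.2| < e / 2 / (`|c| + 1).
  exact: (@cvg_snd _ _ (nbhs s0) (nbhs x0) _) _ near2.
move: n1 n2; apply: filterS2 => -[s x] /= [h1 h2] h3.
rewrite -(subrKA (B s x0)) (le_lt_trans (ler_normD _ _)) //.
rewrite [ltRHS]splitr ler_ltD // -linearB (le_trans (bl_norm_le _ _)) // distrC.
move: h3; rewrite ltr_pdivlMr ?ltr_wpDl // mulrC => /ltW; apply: le_trans.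
rewrite ler_wpM2r // (le_trans h1) // (le_trans (ler_norm c)) // lerDl.
exact: ler01.
Qed.

Lemma norm_continuous_locally_bounded (T : topologicalType) (Z : normedModType R)
    (B : T -> Z) (s0 : T) : continuous B -> exists c, \forall s \near s0, `|B s| <= c.
Proof.
move=> cB; exists (`|B s0| + 1).
have := cB s0; move=> /cvgr_distC_lt/(_ 1 ltr01); apply: filterS => s /ltW h.
by rewrite -lerBlDl (le_trans _ h) // lerB_dist.
Qed.

Lemma bounded_bilinear_continuous (X Y Z : normedModType R) (b : X -> Y -> Z) :
  (forall y, linear (b^~ y)) -> (forall x, linear (b x)) ->
  (forall x y, `|b x y| <= `|x| * `|y|) ->
  continuous (fun p : X * Y => b p.1 p.2).
Proof.
move=> bl br bn.
have bP x : b x \in bl_pred (X := Y) (Y := Z).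
  by apply/asboolP; split; [exact: br|exists `|x|; exact: bn].
apply: (@strongly_continuous_joint X Y Z (fun x => BoundedLinear (bP x))) => /=.
  move=> y; have lP : b^~ y \in bl_pred (X := X) (Y := Z).
    apply/asboolP; split; first exact: bl.
    by exists `|y| => x; rewrite mulrC.
  have := @bl_continuous R X Z (@BoundedLinear R X Z (b^~ y) lP). exact.
move=> x0; have [c cP] := norm_continuous_locally_bounded (B := id) x0 (fun=> cvg_id).
exists c; move: cP; apply: filterS => x xc; apply: opnorm_le => y y1 /=.
by rewrite (le_trans (bn _ _)) // (le_trans _ xc) // ler_piMr.
Qed.

End StronglyContinuousFamilies.

Section TopologicalGroups.
Context {R : realType} {G : topologicalGroupType}.

Lemma locally_compact_nbhs (s : G) : locally_compact [set: G] ->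
  exists2 K : set G, nbhs s K & compact K.
Proof.
move=> /(_ s Logic.I)[K sK [cK _]]; exists K => //.
by move: sK; rewrite /within /=; apply: filterS => t; apply.
Qed.

Lemma continuous_mulg (T : topologicalType) (u v : T -> G) :
  continuous u -> continuous v -> continuous (fun t => (u t * v t)%g).
Proof.
move=> cu cv t.
apply: (@continuous_comp _ _ _ (fun t => (u t, v t)) (fun p : G * G => (p.1 * p.2)%g)).
  by apply: cvg_pair; [exact: cu|exact: cv].
exact: mulg_continuous.
Qed.

Lemma continuous_invg (T : topologicalType) (u : T -> G) :
  continuous u -> continuous (fun t => (u t)^-1%g).
Proof.
by move=> cu t; apply: continuous_comp; [exact: cu|exact: invg_continuous].
Qed.

Lemma compact_mulg (K L : set G) : compact K -> compact L ->
  compact [set (p.1 * p.2)%g | p in K `*` L].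
Proof.
move=> cK cL; apply: continuous_compact; last exact: compact_setX.
apply: continuous_subspaceT; exact: mulg_continuous.
Qed.

(** The image of [mu] under a translation is [mu]. *)
Lemma Rintegral_left_translate (mu : {measure set (borel G) -> \bar R})
    (r : G) (g : G -> R) : left_haar_measure mu -> continuous g ->
  mu.-integrable setT (EFin \o (fun s : borel G => g (r^-1 * s)%g)) ->
  \int[mu]_s g (r^-1 * s)%g = \int[mu]_s g s.
Proof.
move=> haar cg ig.
pose phi : borel G -> borel G := fun s => (r^-1 * s)%g.
have mphi : measurable_fun setT phi.
  have := @measurability _ _ (borel G) (borel G) setT phi (@open G) erefl.
  apply=> _ [U oU <-]; rewrite setTI.
  apply: borel_open; move: U oU; apply/continuousP.
  apply: (continuous_mulg (u := fun=> r^-1%g) (v := id)) => [|s]; first exact: cst_continuous.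
  exact: cvg_id.
have mg : measurable_fun setT (EFin \o (g : borel G -> R)).
  by apply/measurable_EFinP; exact: borel_continuous.
rewrite /Rintegral; congr fine.
have /= <- := integral_pushforward mphi mg ig measurableT.
apply: eq_measure_integral => B mB _.
rewrite /= /pushforward -(haar_left haar r mB); congr (mu _).
apply/seteqP; split=> [s Bs|_ [t Bt <-]] /=; last by rewrite /phi mulKg.
by exists (phi s) => //; rewrite /phi mulVKg.
Qed.

End TopologicalGroups.

(** * Twisted convolution *)

Section CompactlySupportedFunctions.
Context {R : realType} {G : topologicalType} {A : normedModType R}.

Lemma Cc_continuous (f : Cc G A) : continuous f.
Proof. by case: f => f /= /asboolP[]. Qed.

Lemma Cc_support (f : Cc G A) :
  exists2 K, compact K & forall s, ~ K s -> f s = 0.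
Proof.
case: f => f /= /asboolP[_ cf]; exists (closure [set s | f s != 0]) => // s ns.
by apply: contra_notP ns => /eqP fs; exact: subset_closure.
Qed.

Lemma Cc_intro (f : G -> A) (K : set G) : hausdorff_space G -> continuous f ->
  compact K -> (forall s, ~ K s -> f s = 0) -> f \in Cc_pred (A := A).
Proof.
move=> hG cf cK f0; apply/asboolP; split=> //.
apply: (subclosed_compact _ cK); first exact: closed_closure.
rewrite (closure_id K).1; last exact: compact_closed.
by apply: closureS => s /= /eqP fs; apply: contra_notP fs; exact: f0.
Qed.

End CompactlySupportedFunctions.

Lemma bl_eval_subproof (R : realType) (X Y : normedModType R) (x : X) :
  (fun T : 'B(X, Y) => T x) \in bl_pred (X := 'B(X, Y)) (Y := Y).
Proof.
by apply/asboolP; split=> //; exists `|x| => T; rewrite mulrC; exact: bl_norm_le.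
Qed.

Definition bl_eval (R : realType) (X Y : normedModType R) (x : X) :
  'B('B(X, Y), Y) := @BoundedLinear R 'B(X, Y) Y _ (bl_eval_subproof Y x).

Lemma linear_at0 (R : pzRingType) (U V : lmodType R) (f : U -> V) :
  linear f -> f 0 = 0.
Proof.
move=> lf; have := lf (-1) 0 0.
by rewrite !scaleN1r oppr0 addr0 addNr.
Qed.

Section Convolution.
Context {R : realType} {G : topologicalGroupType} {A : completeNormedModType R}.
Variables (mu : {measure set (borel G) -> \bar R}).
Variables (mul : A -> A -> A) (alpha : G -> 'B(A, A)) (Apos : set A).
Hypothesis haar : left_haar_measure mu.
Hypothesis dyn : dynamical_system mul alpha Apos.

Let hausG : hausdorff_space G := (dyn_group dyn).1.
Let mu_compact := haar_compact haar.

Lemma action_joint_continuous : continuous (fun p : G * A => alpha p.1 p.2).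
Proof.
apply: strongly_continuous_joint; first exact: dyn_continuous dyn.
move=> s0; have [K sK cK] := locally_compact_nbhs s0 (dyn_group dyn).2.
have [c _ cP] := strongly_continuous_bounded cK (dyn_continuous dyn).
by exists c; move: sK; apply: filterS.
Qed.

Definition convolution_integrand (f g : G -> A) (p : G * G) : A :=
  mul (f p.1) (alpha p.1 (g (p.1^-1 * p.2)%g)).

Lemma convolution_integrand_continuous (f g : G -> A) :
  continuous f -> continuous g -> continuous (convolution_integrand f g).
Proof.
move=> cf cg.
have [_ ll lr nm _ _] := dyn_algebra dyn.
have ctr : continuous (fun p : G * G => (p.1^-1 * p.2)%g).
  apply: continuous_mulg; last by move=> p; exact: cvg_snd.
  by apply: continuous_invg => p; exact: cvg_fst.
move=> p; apply: (@continuous_comp _ _ _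
  (fun p : G * G => (f p.1, alpha p.1 (g (p.1^-1 * p.2)%g)))
  (fun q : A * A => mul q.1 q.2)); last first.
  exact: (bounded_bilinear_continuous ll lr nm).
apply: cvg_pair => /=.
  by apply: (continuous_comp (f := fst)); [exact: cvg_fst|exact: cf].
apply: (@continuous_comp _ _ _
  (fun p : G * G => (p.1, g (p.1^-1 * p.2)%g))
  (fun q : G * A => alpha q.1 q.2)); last exact: action_joint_continuous.
apply: cvg_pair => /=; first exact: cvg_fst.
by apply: (continuous_comp (f := fun p : G * G => (p.1^-1 * p.2)%g));
  [exact: ctr|exact: cg].
Qed.

Let mul0 b : mul 0 b = 0.
Proof. exact: linear_at0 (alg_linl (dyn_algebra dyn) b). Qed.
Let mulr0' a : mul a 0 = 0.
Proof. exact: linear_at0 (alg_linr (dyn_algebra dyn) a). Qed.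

(** The integrand is jointly continuous because the action is locally bounded, so
its integral over the first variable depends continuously on the second; it
vanishes unless [s] lies in the product of the two supports. *)
Lemma twisted_convolution_exists (f g : Cc G A) :
  exists h, twisted_convolution mu mul alpha f g h.
Proof.
have [K1 cK1 f0] := Cc_support f; have [K2 cK2 g0] := Cc_support g.
have cF := convolution_integrand_continuous (@Cc_continuous _ _ _ f)
  (@Cc_continuous _ _ _ g).
have F1 r s : ~ K1 r -> convolution_integrand f g (r, s) = 0.
  by move=> /f0; rewrite /convolution_integrand /= => ->; rewrite mul0.
have /choice[h hP] : forall s, exists y,
    is_integral mu (fun r => convolution_integrand f g (r, s)) y.
  move=> s; apply: (is_integral_exists hausG mu_compact cK1) => [|r /F1//].
  exact: continuous_pair_l.
have ch : continuous h := is_integral_continuous hausG mu_compact cK1 cF F1 hP.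
have hC : h \in Cc_pred (A := A).
  apply: (Cc_intro hausG ch (compact_mulg cK1 cK2)) => s ns.
  apply: (is_integral_unique (hP s)).
  rewrite (_ : (fun r => _) = (fun r => 0)); last first.
    apply/funext => r; have [Kr|/F1 //] := pselect (K1 r).
    rewrite /convolution_integrand /= g0 ?linear0 ?mulr0' // => Ks.
    by apply: ns; exists (r, (r^-1 * s)%g) => //=; rewrite mulVKg.
  move=> phi; rewrite linear0; split; first exact: integrable0.
  by rewrite Rintegral_cst // mul0r.
by exists (MkCc hC).
Qed.

(** The integrand takes its values in the closed cone [Apos]. *)
Lemma twisted_convolution_positive (f g h : Cc G A) :
  twisted_convolution mu mul alpha f g h ->
  (forall s, Apos (f s)) -> (forall s, Apos (g s)) -> forall s, Apos (h s).
Proof.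
move=> fgh fpos gpos s.
have [K1 cK1 f0] := Cc_support f.
have cF := convolution_integrand_continuous (@Cc_continuous _ _ _ f)
  (@Cc_continuous _ _ _ g).
apply: (is_integral_cone hausG mu_compact cK1 _ _ (fgh s)).
- exact: (continuous_pair_l (s := s) cF).
- by move=> r /f0 ->; rewrite mul0.
- exact: alg_cone (dyn_algebra dyn).
- exact: dyn_closed dyn.
move=> r; apply: (alg_cone_mul (dyn_algebra dyn)) => //.
by have [_ [S [_ _ + _]]] := dyn_aut dyn r; apply.
Qed.

End Convolution.

(** * Integrated forms of covariant representations *)

Section IntegratedForm.
Context {R : realType} {G : topologicalGroupType} {A : completeNormedModType R}.
Variables (mu : {measure set (borel G) -> \bar R}).
Variables (mul : A -> A -> A) (alpha : G -> 'B(A, A)).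
Hypothesis haar : left_haar_measure mu.
Hypothesis lcG : locally_compact_group G.
Variable rho : covariant_rep mul alpha.

Let X := cov_space rho.
Let pi := cov_pi rho.
Let U := cov_U rho.
Let hausG : hausdorff_space G := lcG.1.
Let mu_compact := haar_compact haar.

Definition orbit_function (f : G -> A) (x : X) (r : G) : X := pi (f r) (U r x).

Let joint_pi (f : Cc G A) : continuous (fun p : G * X => pi (f p.1) p.2).
Proof.
have cpf : continuous (fun r => pi (f r)).
  by move=> r; apply: continuous_comp; [exact: Cc_continuous|exact: bl_continuous].
apply: (@strongly_continuous_joint _ G X X (fun r => pi (f r))).
  move=> y r; apply: (@continuous_comp _ _ _ (fun r => pi (f r))
    (bl_eval X y)); [exact: cpf|exact: bl_continuous].
by move=> r; exact: norm_continuous_locally_bounded.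
Qed.

Let joint_U : continuous (fun p : G * X => U p.1 p.2).
Proof.
apply: strongly_continuous_joint; first exact: cov_U_continuous.
move=> s0; have [K sK cK] := locally_compact_nbhs s0 lcG.2.
have [c _ cP] := strongly_continuous_bounded cK (cov_U_continuous (c := rho)).
by exists c; move: sK; apply: filterS.
Qed.

Lemma orbit_function_continuous (f : Cc G A) (x : X) :
  continuous (orbit_function f x).
Proof.
move=> r; apply: (@continuous_comp _ _ _ (fun r => (r, U r x))
  (fun p : G * X => pi (f p.1) p.2)); last exact: joint_pi.
by apply: cvg_pair; [exact: cvg_id|exact: cov_U_continuous].
Qed.

Lemma orbit_function0 (f : Cc G A) (x : X) (r : G) :
  f r = 0 -> orbit_function f x r = 0.
Proof. by rewrite /orbit_function => ->; rewrite linear0. Qed.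

Lemma orbit_function_le (f : Cc G A) (x : X) (r : G) (c M N : R) :
  `|f r| <= c -> `|pi| <= M -> `|U r| <= N ->
  `|orbit_function f x r| <= M * c * N * `|x|.
Proof.
move=> fc piM UN; rewrite (le_trans (bl_norm_le _ _)) // -mulrA ler_pM //.
  by rewrite (le_trans (bl_norm_le _ _)) // ler_pM.
by rewrite (le_trans (bl_norm_le _ _)) // ler_wpM2r.
Qed.

(** The pointwise integrals depend linearly on [x] by uniqueness, and boundedly
since [U] is bounded on the compact support of [f]; so an operator with the
defining property exists and the default value of [xget] is never taken. *)
Lemma integrated_formP (f : Cc G A) (x : X) :
  is_integral mu (orbit_function f x) (integrated_form mu rho f x).
Proof.
suff [T TP] : exists T : 'B(X, X), forall x, is_integral mu (orbit_function f x) (T x).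
  have := @xgetPex _ 0 [set T : 'B(X, X) | forall x,
    is_integral mu (fun r => pi (f r) (U r x)) (T x)] (ex_intro _ T TP).
  exact.
have [K cK f0] := Cc_support f.
have of0 y r : ~ K r -> orbit_function f y r = 0.
  by move=> /f0; exact: orbit_function0.
have [t tP] := choice (fun y => is_integral_exists hausG mu_compact cK
  (@orbit_function_continuous f y) (of0 y)).
have [c _ fc] := continuous_compact_bounded cK (@Cc_continuous _ _ _ f).
have [N _ UN] := strongly_continuous_bounded cK (cov_U_continuous (c := rho)).
have tB : t \in bl_pred (X := X) (Y := X).
  apply/asboolP; split=> [a y z|].
    apply: (is_integral_unique (tP _)).
    have := is_integralD (is_integralZ a (tP y)) (tP z).
    by under eq_fun do rewrite /orbit_function -!linearP.
  exists (`|pi| * c * N * fine (mu K)) => y; rewrite mulrAC.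
  apply: (is_integral_norm_le hausG mu_compact cK (of0 y) _ (tP y)) => r Kr.
  by apply: orbit_function_le => //; [exact: fc|exact: UN].
by exists (BoundedLinear tB).
Qed.

(** The bound depends on [rho] only through bounds on [pi] and, over [K], on [U];
this is what makes the crossed seminorm finite. *)
Lemma integrated_form_le (f : Cc G A) (K : set G) (c M N : R) :
  compact K -> (forall s, ~ K s -> f s = 0) -> 0 <= c -> 0 <= M -> 0 <= N ->
  (forall s, K s -> `|f s| <= c) -> `|pi| <= M -> (forall s, K s -> `|U s| <= N) ->
  `|integrated_form mu rho f| <= M * c * N * fine (mu K).
Proof.
move=> cK f0 c0 M0 N0 fc piM UN.
apply: bl_norm_ub => [|x]; first by rewrite !mulr_ge0 // fine_ge0.
rewrite mulrAC.
apply: (is_integral_norm_le hausG mu_compact cK _ _ (integrated_formP f x)).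
  by move=> s /f0; exact: orbit_function0.
by move=> s Ks; apply: orbit_function_le => //; [exact: fc|exact: UN].
Qed.

Lemma integrated_form_linear : linear (integrated_form mu rho).
Proof.
move=> a f g; apply: val_inj; apply/funext => x /=.
apply: (is_integral_unique (integrated_formP _ x)).
have := is_integralD (is_integralZ a (integrated_formP f x)) (integrated_formP g x).
by under eq_fun do rewrite /orbit_function -[_ + _]/((a *: pi (f _) + pi (g _)) _) -linearP.
Qed.

Lemma integrated_form_positive (Apos : set A) (L : set X) (f : Cc G A) :
  is_cone L -> closed L -> positive_rep Apos L -> (forall s, Apos (f s)) ->
  positive_maps L L (integrated_form mu rho f).
Proof.
move=> coneL clL [pipos Upos] fpos x Lx; have [K cK f0] := Cc_support f.
apply: (is_integral_cone hausG mu_compact cK _ _ (integrated_formP f x)) => //.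
- exact: orbit_function_continuous.
- by move=> r /f0; exact: orbit_function0.
move=> r; apply: pipos => //.
by have [S [_ _ UL _]] := Upos r; exact: UL.
Qed.

(** By duality it suffices to compare scalar double integrals. Covariance turns
the integrand of the left-hand side into that of the right-hand side, up to the
translation [s |-> r^-1 * s], under which [mu] is invariant. *)
Theorem integrated_form_multiplicative (f g h : Cc G A) (x : X) :
  twisted_convolution mu mul alpha f g h ->
  integrated_form mu rho h x =
    integrated_form mu rho f (integrated_form mu rho g x).
Proof.
move=> fgh.
have [K1 cK1 f0] := Cc_support f; have [K2 cK2 g0] := Cc_support g.
set y := integrated_form mu rho g x.
apply/eqP; rewrite -subr_eq0 -normr_le0; apply: dual_norm_le => phi _.
rewrite linearB /= (integrated_formP h x phi).2 (integrated_formP f y phi).2.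
pose w := orbit_function g x.
have cw : continuous w by exact: orbit_function_continuous.
pose chi r : 'B(X, R^o) := bl_comp phi (bl_comp (pi (f r)) (U r)).
pose F (p : G * G) : R^o := chi p.1 (w (p.1^-1 * p.2)%g).
have cF : continuous F.
  move=> p; apply: (@continuous_comp _ _ _
    (fun p : G * G => pi (f p.1) (U p.1 (w (p.1^-1 * p.2)%g))) phi);
    last exact: bl_continuous.
  apply: (@continuous_comp _ _ _
    (fun p : G * G => (p.1, U p.1 (w (p.1^-1 * p.2)%g)))
    (fun q : G * X => pi (f q.1) q.2)); last exact: joint_pi.
  apply: cvg_pair; first exact: cvg_fst.
  apply: (@continuous_comp _ _ _
    (fun p : G * G => (p.1, w (p.1^-1 * p.2)%g))
    (fun q : G * X => U q.1 q.2)); last exact: joint_U.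
  apply: cvg_pair; first exact: cvg_fst.
  apply: (@continuous_comp _ _ _ (fun p : G * G => (p.1^-1 * p.2)%g) w); last exact: cw.
  apply: continuous_mulg; last by move=> q; exact: cvg_snd.
  by apply: continuous_invg => q; exact: cvg_fst.
have F1 r s : ~ K1 r -> F (r, s) = 0.
  by move=> /f0 fr; rewrite /F /chi /= fr linear0 /= linear0.
pose K3 := [set (p.1 * p.2)%g | p in K1 `*` K2].
have F2 r s : ~ K3 s -> F (r, s) = 0.
  move=> ns; have [Kr|/F1//] := pselect (K1 r).
  rewrite /F /w /= orbit_function0 ?linear0 //; apply: g0 => Ks.
  by apply: ns; exists (r, (r^-1 * s)%g) => //=; rewrite mulVKg.
have cK3 : compact K3 by exact: compact_mulg.
have lhsE s : phi (orbit_function h x s) = \int[mu]_r F (r, s).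
  pose psi : 'B(A, R^o) := bl_comp phi (bl_comp (bl_eval X (U s x)) pi).
  rewrite -[LHS]/(psi (h s)) (fgh s psi).2; apply: eq_Rintegral => r _.
  rewrite /psi /F /chi /w /orbit_function /= cov_pi_mul cov_covariant.
  by rewrite -cov_U_morph.
have rhsE r : phi (orbit_function f y r) = \int[mu]_s F (r, s).
  rewrite -[LHS]/(chi r y) (integrated_formP g x (chi r)).2.
  rewrite -(Rintegral_left_translate (r := r) haar) //.
    by move=> s; apply: continuous_comp; [exact: cw|exact: bl_continuous].
  apply: (integrable_support (borel_compact hausG cK3) (F2 r)).
  apply: integrable_continuous => //.
  exact: (continuous_pair_r (t := r) cF).
under eq_Rintegral do rewrite lhsE.
under [X in _ - X]eq_Rintegral do rewrite rhsE.
rewrite (fubini_compact_support hausG mu_compact cK1 cK3 cF F1 F2).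
by rewrite subrr normr0.
Qed.

End IntegratedForm.

(** * Partitions of unity *)

Lemma continuous_big_sum (R : realType) (T : topologicalType)
    (X : normedModType R) (I : Type) (l : seq I) (F : I -> T -> X) :
  (forall i, continuous (F i)) -> continuous (fun t => \sum_(i <- l) F i t).
Proof.
move=> cF; elim: l => [|i l IH].
  under eq_fun do rewrite big_nil; exact: cst_continuous.
under eq_fun do rewrite big_cons.
by move=> t; apply: cvgD; [exact: cF|exact: IH].
Qed.

Section PartitionOfUnity.
Context {R : realType} {T : ptopologicalType}.
Hypothesis hausT : hausdorff_space T.
Hypothesis lcT : locally_compact [set: T].

Lemma bump_function (s : T) (V : set T) : nbhs s V ->
  exists phi : T -> R, [/\ continuous phi, forall t, 0 <= phi t,
    phi s = 1 & forall t, ~ V t -> phi t = 0].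
Proof.
rewrite nbhsE => -[U [oU Us] UV].
have sep : uniform_separator [set s] (~` U).
  apply: (locally_compact_completely_regular (R := R) lcT hausT).
    exact: open_closedC.
  by move=> /(_ Us).
have /uniform_separatorP := sep => /(_ R)[g [cg g01 gs gU]].
exists (fun t => 1 - g t); split=> [t|t||t nVt].
- by apply: cvgB; [exact: cvg_cst|exact: cg].
- have : `[0, 1]%classic (g t) by apply: g01; exists t.
  by rewrite /= in_itv /= subr_ge0 => /andP[].
- by rewrite (gs (g s)) ?subr0 //; exists s.
by rewrite (gU (g t)) ?subrr //; exists t => // /UV.
Qed.

(** Finitely many compact neighborhoods of points of [K] cover [K]. *)
Lemma compact_neighborhood (K : set T) : compact K ->
  exists2 W, compact W & forall s, K s -> nbhs s W.
Proof.
move=> cK.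
have /choice[N NP] : forall s : T, exists N, nbhs s N /\ compact N.
  move=> s; have [N sN [cN _]] := lcT (x := s) Logic.I.
  by exists N; split=> //; move: sN; rewrite /within /=; apply: filterS => t; apply.
have [l lK lcov] := compact_finite_net cK (fun s _ => (NP s).1).
exists [set t | exists2 x, x \in l & N x t].
  elim: (l) => [|x l' IH].
    rewrite (_ : [set _ | _] = set0) //; first exact: compact0.
    by rewrite -subset0 => t [].
  rewrite (_ : [set _ | _] = N x `|` [set t | exists2 x, x \in l' & N x t]).
    by apply: compactU => //; exact: (NP x).2.
  apply/seteqP; split=> [t [y]|t [Nt|[y yl Nt]]].
  - by rewrite inE => /predU1P[-> ?|yl Nt]; [left|right; exists y].
  - by exists x; rewrite ?mem_head.
  - by exists y; rewrite // inE yl orbT.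
move=> s /lcov[x xl]; rewrite /interior; apply: filterS => t Nt.
by exists x.
Qed.

Lemma continuous_divr (u v : T -> R) : continuous u -> continuous v ->
  (forall t, v t != 0) -> continuous (fun t => u t / v t).
Proof.
move=> cu cv v0 t; apply: cvgM; first exact: cu.
by apply: cvgV => //; exact: cv.
Qed.

(** A partition of unity [theta] on the support of [f]; the bumps are divided by
the maximum of their sum and [1 / 2], which is continuous without zeros and
equals their sum on [K]. *)
Lemma tensor_approximation (X : normedModType R) (f : T -> X) (K : set T) :
  continuous f -> compact K -> (forall t, ~ K t -> f t = 0) ->
  exists2 W, compact W & (forall t, ~ W t -> f t = 0) /\
  forall e : R, 0 < e -> exists (l : seq T) (theta : T -> T -> R),
  [/\ forall x, continuous (theta x), forall x t, 0 <= theta x t,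
      forall x t, x \in l -> ~ W t -> theta x t = 0 &
      forall t, `|f t - \sum_(x <- l) theta x t *: f x| <= e].
Proof.
move=> cf cK f0; have [W cW KW] := compact_neighborhood cK.
exists W => //; split=> [t nWt|e e0].
  by apply: f0 => /KW /nbhs_singleton.
have /choice[phi phiP] : forall s, exists phi : T -> R,
    [/\ continuous phi, forall t, 0 <= phi t, K s -> phi s = 1 &
      K s -> forall t, ~ (W t /\ `|f t - f s| < e) -> phi t = 0].
  move=> s; have [Ks|nKs] := pselect (K s); last first.
    by exists (fun=> 0); split=> // t; exact: cvg_cst.
  have [|phi [cphi phi0 phis phiV]] :=
      @bump_function s [set t | W t /\ `|f t - f s| < e].
    apply: filterI; first exact: KW.
    by have := cf s; move=> /cvgr_distC_lt; apply.
  by exists phi; split.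
have [s Ks|l lK lcov] :=
    compact_finite_net (V := fun s => [set t | 2^-1 < phi s t]) cK.
  have [cphi _ phis _] := phiP s.
  have := cphi s; rewrite /continuous_at phis // => /cvgr_gt; apply.
  by rewrite invf_lt1 ?ltr1n.
pose S t := \sum_(x <- l) phi x t.
pose D t := Num.max (S t) 2^-1.
have cS : continuous (S : T -> R^o).
  by apply: continuous_big_sum => x; have [] := phiP x.
have cD : continuous D.
  by move=> t; apply: (@continuous_max _ _ S (fun=> 2^-1)); [exact: cS|exact: cvg_cst].
have D0 t : 0 < D t by rewrite lt_max invr_gt0 ltr0n orbT.
exists l, (fun x t => phi x t / D t); split=> [x|x t|x t xl nWt|t].
- by apply: continuous_divr => // [|t]; [have [] := phiP x|rewrite gt_eqF].
- by have [_ phi0 _ _] := phiP x; rewrite divr_ge0 // ltW.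
- have [_ _ _ ->] := phiP x; rewrite ?mul0r //; first exact: lK.
  by case.
(* The weights add up to 1 on [K], and off [K] both sides vanish. *)
have fE : f t = \sum_(x <- l) (phi x t / D t) *: f t.
  rewrite -scaler_suml -mulr_suml -/(S t).
  have [Kt|/f0 ->] := pselect (K t); last by rewrite scaler0.
  have [x xl /interior_subset /= xt] := lcov t Kt.
  have : 2^-1 <= S t.
    rewrite (le_trans (ltW xt)) // /S (big_rem x xl) /= lerDl sumr_ge0 // => y _.
    by have [_ phi0 _ _] := phiP y.
  by move=> /max_idPl DS; rewrite -[X in X / _]DS divff ?scale1r // gt_eqF // D0.
rewrite [X in X - _]fE -sumrB (le_trans (ler_norm_sum _ _ _)) //.
apply: (@le_trans _ _ (\sum_(x <- l) (phi x t / D t) * e)).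
  rewrite big_seq [leRHS]big_seq; apply: ler_sum => x xl.
  have [_ phi0 _ phiV] := phiP x.
  rewrite -scalerBr normrZ ger0_norm ?divr_ge0 ?(ltW (D0 t)) //.
  have [[_ /ltW fe]|/(phiV (lK x xl)) ->] := pselect (W t /\ `|f t - f x| < e).
    by rewrite ler_wpM2l // divr_ge0 ?(ltW (D0 t)).
  by rewrite !mul0r.
rewrite -mulr_suml -mulr_suml -/(S t) ler_piMl //; first exact: ltW.
by rewrite ler_pdivrMr // mul1r le_max lexx.
Qed.

End PartitionOfUnity.

(** * Extension to the completion *)

Section Extension.
Context {R : realType}.
Implicit Types V W X Y : normedModType R.

(** Sequential completeness suffices to extend maps to the completion, and it
passes from [Y] to ['B(X, Y)] without giving the latter a new structure. *)
Definition seq_complete W := forall u : nat -> W,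
  cauchy (u @ \oo) -> exists l : W, u @ \oo --> l.

Lemma complete_seq_complete (W : completeNormedModType R) : seq_complete W.
Proof. by move=> u /cauchy_cvgP/cvg_ex. Qed.

Lemma bl_cauchy_eval X Y (u : nat -> 'B(X, Y)) x : cauchy (u @ \oo) ->
  cauchy ((fun n => u n x) @ \oo).
Proof.
move=> /(cauchy_seqP _).1 cu; apply: (cauchy_seqP _).2 => e e0.
have [n nu] := cu (e / (`|x| + 1)) (divr_gt0 e0 (ltr_wpDl (normr_ge0 x) ltr01)).
exists n => i j ni nj; have := nu i j ni nj.
rewrite ltr_pdivlMr ?ltr_wpDl //; apply: le_lt_trans.
rewrite (le_trans (bl_norm_le (u i - u j) x)) // ler_wpM2l // lerDl.
exact: ler01.
Qed.

Lemma bl_seq_complete X Y : seq_complete Y -> seq_complete 'B(X, Y).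
Proof.
move=> cY u cu.
have [t tP] := choice (fun x => cY _ (bl_cauchy_eval x cu)).
have tlin : linear t.
  move=> a x y; apply: (@cvg_unique _ (@norm_hausdorff _ Y)
    ((fun n => u n (a *: x + y)) @ \oo)) => //.
    exact: tP.
  have -> : (fun n => u n (a *: x + y)) = (fun n => a *: u n x + u n y).
    by apply/funext => n; rewrite linearP.
  by apply: cvgD; [apply: cvgZr; exact: tP|exact: tP].
have close e : 0 < e -> exists n, forall i, (n <= i)%N -> forall x,
    `|u i x - t x| <= e * `|x|.
  move=> e0; have [n nu] := (cauchy_seqP _).1 cu e e0.
  exists n => i ni x.
  have dist : (fun j => `|u i x - u j x|) @ \oo --> `|u i x - t x|.
    by apply: cvg_norm; apply: cvgB; [exact: cvg_cst|exact: tP].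
  apply: (ler_cvg_to dist (cvg_cst (e * `|x|))).
  exists n => // j /= nj; rewrite (le_trans (bl_norm_le (u i - u j) x)) //.
  by rewrite ler_wpM2r // ltW // nu.
have tB : t \in bl_pred (X := X) (Y := Y).
  apply/asboolP; split=> //; have [n nP] := close 1 ltr01.
  exists (`|u n| + 1) => x; have := nP n (leqnn n) x; rewrite mul1r => ux.
  rewrite mulrDl mul1r -lerBlDl (le_trans _ ux) // distrC.
  by rewrite (le_trans _ (lerB_dist _ _)) // lerB // bl_norm_le.
exists (BoundedLinear tB); apply/cvgrPdistC_le => e e0.
have [n nP] := close e e0; exists n => // i /= ni.
by apply: bl_norm_ub => [|x]; [exact: ltW|exact: nP].
Qed.

Lemma completion_bl_subproof V :
  @completion_in R V \in bl_pred (X := V) (Y := completion V).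
Proof.
apply/asboolP; split; first exact: completion_in_linear.
by exists 1 => v; rewrite mul1r completion_in_norm.
Qed.

Definition completion_bl V : 'B(V, completion V) :=
  @BoundedLinear R V (completion V) _ (completion_bl_subproof V).

Lemma completion_inB V (x y : V) :
  completion_in (x - y) = completion_in x - completion_in y.
Proof. exact: (linearB (completion_bl V)). Qed.

Lemma completion_inD V (x y : V) :
  completion_in (x + y) = completion_in x + completion_in y.
Proof. exact: (linearD (completion_bl V)). Qed.

Lemma completion_inZ V (a : R) (x : V) :
  completion_in (a *: x) = a *: completion_in x.
Proof. exact: (linearZ_LR (completion_bl V)). Qed.

Lemma completion_in0 V : completion_in (0 : V) = 0.
Proof. exact: (linear0 (completion_bl V)). Qed.

Lemma completion_in_cvg V (c : completion V) :
  exists u : nat -> V, cauchy (u @ \oo) /\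
    (fun n => completion_in (u n)) @ \oo --> c.
Proof.
have h0 n : 0 < n.+1%:R^-1 :> R by rewrite invr_gt0.
have [u uP] := choice (fun n => completion_in_dense c (h0 n)).
have cu : (fun n => completion_in (u n)) @ \oo --> c.
  apply/cvgrPdist_lt => e e0.
  have := @cvg_harmonic R => /cvgrPdist_lt/(_ e e0); apply: filterS => n /=.
  by rewrite sub0r normrN ger0_norm //; exact/lt_trans/uP.
exists u; split=> //; apply: (cauchy_seqP _).2 => e e0.
have /cvgrPdist_lt/(_ _ (divr_gt0 e0 (@ltr0Sn _ 1)))[n _ nP] := cu.
exists n => i j ni nj.
rewrite -completion_in_norm completion_inB -(subrKA c).
rewrite (le_lt_trans (ler_normD _ _)) // [ltRHS]splitr.
by rewrite ltrD //; [rewrite distrC|]; exact: nP.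
Qed.

(** The image of [c] is the limit of [f] along any sequence that tends to [c]; the
estimate [FP] shows that it does not depend on the sequence. *)
Lemma completion_extension V W (f : 'B(V, W)) : seq_complete W ->
  exists F : 'B(completion V, W),
    (forall v, F (completion_in v) = f v) /\ `|F| <= `|f|.
Proof.
move=> cW.
have fu (u : nat -> V) : cauchy (u @ \oo) -> cauchy ((fun n => f (u n)) @ \oo).
  move=> /(cauchy_seqP _).1 cu; apply: (cauchy_seqP _).2 => e e0.
  have [n nP] := cu _ (divr_gt0 e0 (ltr_wpDl (normr_ge0 f) ltr01)).
  exists n => i j ni nj; have := nP i j ni nj.
  rewrite ltr_pdivlMr ?ltr_wpDl // -linearB mulrC; apply: le_lt_trans.
  by rewrite (le_trans (bl_norm_le _ _)) // ler_wpM2r // lerDl.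
have /choice[F FP] : forall c : completion V, exists l : W,
    forall v, `|l - f v| <= `|f| * `|c - completion_in v|.
  move=> c; have [u [cu uc]] := completion_in_cvg c.
  have [l ul] := cW _ (fu u cu); exists l => v.
  have lhs : (fun n => `|f (u n) - f v|) @ \oo --> `|l - f v|.
    by apply: cvg_norm; apply: cvgB; [exact: ul|exact: cvg_cst].
  have rhs : (fun n => `|f| * `|completion_in (u n) - completion_in v|) @ \oo -->
      `|f| * `|c - completion_in v|.
    apply: cvgMr; apply: cvg_norm; apply: cvgB; [exact: uc|exact: cvg_cst].
  apply: (ler_cvg_to lhs rhs); apply: nearW => n.
  by rewrite -completion_inB -linearB completion_in_norm bl_norm_le.
have Fcvg c (u : nat -> V) : (fun n => completion_in (u n)) @ \oo --> c ->
    (fun n => f (u n)) @ \oo --> F c.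
  move=> uc; apply/cvgrPdist_le => e e0.
  have d0 : 0 < e / (`|f| + 1) by rewrite divr_gt0 // ltr_wpDl.
  have /cvgrPdist_lt/(_ _ d0) := uc; apply: filterS => n /=.
  rewrite ltr_pdivlMr ?ltr_wpDl // => /ltW cn.
  rewrite (le_trans (FP c (u n))) // (le_trans _ cn) // mulrC ler_wpM2l //.
  by rewrite lerDl.
have FE v : F (completion_in v) = f v.
  apply/eqP; rewrite -subr_eq0 -normr_le0 (le_trans (FP _ v)) //.
  by rewrite subrr normr0 mulr0.
have Fn c : `|F c| <= `|f| * `|c|.
  by have := FP c 0; rewrite linear0 completion_in0 !subr0.
have Flin : linear F.
  move=> a c d; have [u [_ uc]] := completion_in_cvg c.
  have [v [_ vd]] := completion_in_cvg d.
  apply: (@cvg_unique _ (@norm_hausdorff _ W) ((fun n => f (a *: u n + v n)) @ \oo)).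
    apply: Fcvg.
    have -> : (fun n => completion_in (a *: u n + v n)) =
        (fun n => a *: completion_in (u n) + completion_in (v n)).
      by apply/funext => n; rewrite completion_in_linear.
    by apply: cvgD => //; exact: cvgZr.
  have -> : (fun n => f (a *: u n + v n)) = (fun n => a *: f (u n) + f (v n)).
    by apply/funext => n; rewrite linearP.
  by apply: cvgD; [apply: cvgZr|]; exact: Fcvg.
have FB : F \in bl_pred (X := completion V) (Y := W).
  by apply/asboolP; split=> //; exists `|f|.
by exists (BoundedLinear FB); split=> //; exact: bl_norm_ub.
Qed.

(** Used to push positivity from a dense subset to the closure, one argument at a
time. *)
Lemma closure_image_closed (T : topologicalType) (S : set T) X (F : T -> X)
    (L : set X) : continuous F -> closed L -> (forall s, S s -> L (F s)) ->
  forall t, closure S t -> L (F t).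
Proof.
move=> cF clL SL t St; apply: clL => U /cF/St[s [Ss Us]].
by exists (F s); split; [exact: SL|].
Qed.

End Extension.

(** * Norming families of representations and the completed algebra *)

Lemma seminorm_factor (R : realType) (V : lmodType R) (N : V -> R)
    (HN : is_seminorm N) (W : normedModType R) (f : V -> W) :
  linear f -> (forall v, `|f v| <= N v) ->
  exists F : 'B(seminorm_quot HN, W),
    (forall v, F (seminorm_pi HN v) = f v) /\ `|F| <= 1.
Proof.
move=> lf fN.
have [rep repP] := choice (seminorm_pi_surj (HN := HN)).
have fB x y : f (x - y) = f x - f y.
  by rewrite addrC -scaleN1r lf scaleN1r addrC.
have fE v : f (rep (seminorm_pi HN v)) = f v.
  apply/eqP; rewrite -subr_eq0 -normr_le0.
  have := (seminorm_piP HN _ _).1 (repP (seminorm_pi HN v)) => <-.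
  by rewrite -fB.
have piD a x y : a *: seminorm_pi HN x + seminorm_pi HN y = seminorm_pi HN (a *: x + y).
  by rewrite seminorm_pi_linear.
have FB : (fun c => f (rep c)) \in bl_pred (X := seminorm_quot HN) (Y := W).
  apply/asboolP; split=> [a c d|].
    rewrite -[in LHS](repP c) -[in LHS](repP d) piD fE lf.
    by [].
  exists 1 => c; rewrite mul1r -[in leRHS](repP c) seminorm_pi_norm.
  exact: fN.
exists (@BoundedLinear R (seminorm_quot HN) W _ FB); split=> [v|]; first exact: fE.
apply: bl_norm_ub => // c; rewrite mul1r -[in leRHS](repP c) seminorm_pi_norm.
exact: fN.
Qed.

Section CompletionCone.
Context {R : realType}.
Implicit Types V : normedModType R.

Lemma closure_cone V (S : set V) : is_cone S -> is_cone (closure S).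
Proof.
move=> [S0 SD SZ]; split; first exact: subset_closure.
  move=> x y Sx Sy.
  apply: (closure_image_closed (F := fun s => s + y) _ (@closed_closure _ S) _ Sx).
    by move=> s; apply: cvgD; [exact: cvg_id|exact: cvg_cst].
  move=> s Ss.
  apply: (closure_image_closed (F := fun t => s + t) _ (@closed_closure _ S) _ Sy).
    by move=> t; apply: cvgD; [exact: cvg_cst|exact: cvg_id].
  by move=> t St; apply: subset_closure; exact: SD.
move=> a x a0 Sx.
apply: (closure_image_closed (F := fun s => a *: s) _ (@closed_closure _ S) _ Sx).
  by move=> s; apply: cvgZr; exact: cvg_id.
by move=> s Ss; apply: subset_closure; exact: SZ.
Qed.

Lemma completion_cone_is_cone V (K : set V) : is_cone K -> is_cone (completion_cone K).
Proof.
move=> [K0 KD KZ]; apply: closure_cone; split.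
- by exists 0 => //; rewrite completion_in0.
- move=> _ _ [v Kv <-] [w Kw <-]; exists (v + w); first exact: KD.
  by rewrite completion_inD.
- move=> a _ a0 [v Kv <-]; exists (a *: v); first exact: KZ.
  by rewrite completion_inZ.
Qed.

Lemma completion_cone_in V (K : set V) v : K v -> completion_cone K (completion_in v).
Proof. by move=> Kv; apply: subset_closure; exists v. Qed.

(** If every element of [V] is dominated by an element of [K] in a way that
preserves Cauchy sequences, the dominating elements of a sequence that tends to
[c] converge to a dominating element of [c]. *)
Lemma completion_cone_generating V (K : set V) (pos : V -> V) :
  (forall v, K (pos v)) -> (forall v, cone_le K v (pos v)) ->
  (forall u : nat -> V, cauchy (u @ \oo) -> cauchy ((pos \o u) @ \oo)) ->
  generating (completion_cone K).
Proof.
move=> Kpos Kle pos_cauchy; rewrite /generating -subTset => c _.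
have [u [cu uc]] := completion_in_cvg c.
have : cauchy ((fun n => completion_in (pos (u n))) @ \oo).
  apply: (cauchy_seqP _).2 => e e0.
  have [n nP] := (cauchy_seqP _).1 (pos_cauchy u cu) e e0.
  exists n => i j ni nj; rewrite -completion_inB completion_in_norm.
  exact: nP.
move=> /complete_seq_complete[p pP].
have clC : closed (completion_cone K) by exact: closed_closure.
exists p, (p - c); split; last by rewrite subKr.
  apply: (closed_cvg _ clC _ _ pP); apply: nearW => n; exact: completion_cone_in.
have dP : (fun n => completion_in (pos (u n)) - completion_in (u n)) @ \oo --> p - c.
  exact: cvgB.
apply: (closed_cvg _ clC _ _ dP); apply: nearW => n.
by rewrite -completion_inB; apply: completion_cone_in; exact: Kle.
Qed.

Lemma completion_cone_topologically_generating V (K : set V) :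
  (forall (v : V) (e : R), 0 < e ->
     exists p q, [/\ K p, K q & `|v - (p - q)| <= e]) ->
  topologically_generating (completion_cone K).
Proof.
move=> Kapprox; rewrite /topologically_generating -subTset => c _.
move=> U /nbhs_normP[e /= e0 cU].
have e20 : 0 < e / 2 by rewrite divr_gt0.
have [v vc] := completion_in_dense c e20.
have [p [q [Kp Kq vpq]]] := Kapprox v (e / 2) e20.
exists (completion_in p - completion_in q); split.
  exists (completion_in p), (completion_in q); split=> //;
  exact: completion_cone_in.
apply: cU; rewrite /= -(subrKA (completion_in v)) (le_lt_trans (ler_normD _ _)) //.
rewrite [ltRHS]splitr ltr_leD //.
by rewrite -!completion_inB completion_in_norm.
Qed.

End CompletionCone.

Section FaithfulFamily.
Context {R : realType} (V : normedModType R) (I : Type) (C : I -> Prop).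
Variables (X : I -> completeNormedModType R) (T : forall i, 'B(V, 'B(X i, X i))).
Hypothesis T_contraction : forall i, C i -> `|T i| <= 1.
Hypothesis T_norming : forall v b, (forall i, C i -> `|T i v| <= b) -> `|v| <= b.

(** Each [T i] is bounded, hence extends to the completion by density; there the
family still determines the norm. *)
Definition extended_rep i : 'B(completion V, 'B(X i, X i)) :=
  sval (cid (completion_extension (T i)
    (bl_seq_complete (@complete_seq_complete R (X i))))).

Let Th := extended_rep.

Lemma extended_repE i v : Th i (completion_in v) = T i v.
Proof. by rewrite /Th /extended_rep; case: cid => F /= []. Qed.

Lemma extended_rep_contraction i c : C i -> `|Th i c| <= `|c|.
Proof.
move=> Ci; rewrite (le_trans (bl_norm_le _ _)) // ler_piMl //.
rewrite (le_trans _ (T_contraction Ci)) //.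
by rewrite /Th /extended_rep; case: cid => F /= [].
Qed.

Lemma extended_rep_norming c b : (forall i, C i -> `|Th i c| <= b) -> `|c| <= b.
Proof.
move=> cb; apply/ler_addgt0Pr => e e0.
have e20 : 0 < e / 2 by rewrite divr_gt0.
have [v /ltW cv] := completion_in_dense c e20.
have vb : `|v| <= b + e / 2.
  apply: T_norming => i Ci; rewrite -extended_repE.
  have -> : completion_in v = c - (c - completion_in v) by rewrite subKr.
  rewrite linearB (le_trans (ler_normB _ _)) // lerD ?cb //.
  by rewrite (le_trans (extended_rep_contraction _ Ci)).
rewrite -[c](subrK (completion_in v)) (le_trans (ler_normD _ _)) //.
rewrite completion_in_norm (le_trans (lerD cv vb)) //.
by rewrite addrCA -splitr.
Qed.

Lemma extended_rep_faithful c d :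
  (forall i, C i -> forall x, Th i c x = Th i d x) -> c = d.
Proof.
move=> cd; apply/eqP; rewrite -subr_eq0 -normr_le0.
apply: extended_rep_norming => i Ci; apply: bl_norm_ub => // x.
by rewrite linearB -[bl_fun _ _]/(Th i c x - Th i d x) cd // subrr normr0 mul0r.
Qed.

Hypothesis T_product : forall v w, exists u,
  forall i, C i -> forall x, T i u x = T i v (T i w x).

Let product_dist i c d c' d' x : C i ->
  `|Th i c (Th i d x) - Th i c' (Th i d' x)| <=
    (`|c| * `|d - d'| + `|c - c'| * `|d'|) * `|x|.
Proof.
move=> Ci; rewrite -(subrKA (Th i c (Th i d' x))).
rewrite (le_trans (ler_normD _ _)) // mulrDl lerD //.
  rewrite -linearB -[_ - _]/((Th i d - Th i d') x) -linearB -mulrA.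
  rewrite (le_trans (bl_norm_le _ _)) // ler_pM ?extended_rep_contraction //.
  rewrite (le_trans (bl_norm_le _ _)) // ler_wpM2r //.
  exact: extended_rep_contraction.
rewrite -[_ - _]/((Th i c - Th i c') (Th i d' x)) -linearB -mulrA.
rewrite (le_trans (bl_norm_le _ _)) // ler_pM ?extended_rep_contraction //.
rewrite (le_trans (bl_norm_le _ _)) // ler_wpM2r //.
exact: extended_rep_contraction.
Qed.

(** Products of approximants of [c] and [d] form a Cauchy sequence: for every [i]
their images are within [a n * `|x|] of [Th i c (Th i d x)], with [a] independent
of [i], and the family determines the norm. *)
Lemma completed_product_exists c d : exists e,
  forall i, C i -> forall x, Th i e x = Th i c (Th i d x).
Proof.
have [u [_ uc]] := completion_in_cvg c; have [v [_ vd]] := completion_in_cvg d.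
have [w wP] := choice (fun n => T_product (u n) (v n)).
pose a n := `|c| * `|d - completion_in (v n)| +
  `|c - completion_in (u n)| * `|completion_in (v n)|.
have a0 : a @ \oo --> (0 : R).
  have -> : 0 = `|c| * `|d - d| + `|c - c| * `|d| :> R.
    by rewrite !subrr normr0 mulr0 mul0r addr0.
  apply: cvgD.
    by apply: cvgMr; apply: cvg_norm; apply: cvgB; [exact: cvg_cst|exact: vd].
  apply: cvgM; last exact: cvg_norm.
  by apply: cvg_norm; apply: cvgB; [exact: cvg_cst|exact: uc].
have wa i n x : C i -> `|Th i c (Th i d x) - T i (w n) x| <= a n * `|x|.
  by move=> Ci; rewrite wP // -!extended_repE; exact: product_dist.
have a_ge0 n : 0 <= a n by rewrite addr_ge0 ?mulr_ge0.
have a_small e : 0 < e -> exists n, forall i, (n <= i)%N -> a i < e.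
  move=> e0; have /cvgrPdist_lt/(_ e e0)[n _ nP] := a0; exists n => i /nP /=.
  by rewrite sub0r normrN ger0_norm.
have cw : cauchy ((fun n => completion_in (w n)) @ \oo).
  apply: (cauchy_seqP _).2 => e e0; have [n nP] := a_small _ (divr_gt0 e0 (@ltr0Sn _ 1)).
  exists n => i j ni nj; rewrite -completion_inB completion_in_norm.
  apply: (@le_lt_trans _ _ (a i + a j)); last by rewrite [ltRHS]splitr ltrD ?nP.
  apply: T_norming => k Ck; apply: bl_norm_ub => [|x]; first exact: addr_ge0.
  rewrite linearB -[bl_fun _ _]/(T k (w i) x - T k (w j) x).
  rewrite -(subrKA (Th k c (Th k d x))) (le_trans (ler_normD _ _)) // mulrDl.
  by rewrite lerD ?wa // distrC wa.
have [e we] := complete_seq_complete cw; exists e => i Ci x.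
have lim1 : (fun n => T i (w n) x) @ \oo --> Th i e x.
  rewrite (_ : (fun n => _) = (fun n => bl_eval (X i) x (Th i (completion_in (w n))))).
    apply: continuous_cvg; first exact: bl_continuous.
    by apply: continuous_cvg; first exact: bl_continuous.
  by apply/funext => n; rewrite /= extended_repE.
apply: (cvg_unique _ lim1); first exact: norm_hausdorff.
apply/cvgrPdist_le => h h0.
have [n nP] := a_small _ (divr_gt0 h0 (ltr_wpDl (normr_ge0 x) ltr01)).
exists n => // j /= /nP/ltW; rewrite ler_pdivlMr ?ltr_wpDl // => jh.
by rewrite (le_trans (wa i j x Ci)) // (le_trans _ jh) // ler_wpM2l // lerDl.
Qed.

(** Multiplication is carried by the family: [c d] is the unique element that every
[extended_rep i] maps to the composition of the images of [c] and [d]. The laws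
of an algebra then follow from those of operators. *)
Definition completed_product c d := sval (cid (completed_product_exists c d)).

Lemma completed_productE i c d x : C i ->
  Th i (completed_product c d) x = Th i c (Th i d x).
Proof. by rewrite /completed_product; case: cid => e /= eP /eP. Qed.

Lemma completed_product_in u v w :
  (forall i, C i -> forall x, T i u x = T i v (T i w x)) ->
  completed_product (completion_in v) (completion_in w) = completion_in u.
Proof.
move=> uvw; apply: extended_rep_faithful => i Ci x.
by rewrite completed_productE // !extended_repE uvw.
Qed.

Lemma completed_productA : associative completed_product.
Proof.
move=> a b c; apply: extended_rep_faithful => i Ci x.
by rewrite !completed_productE.
Qed.

Lemma completed_product_linl d : linear (completed_product^~ d).
Proof.
move=> a b c; apply: extended_rep_faithful => i Ci x.
by rewrite linearP -[RHS]/(a *: Th i _ x + Th i _ x) !completed_productE // linearP.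
Qed.

Lemma completed_product_linr c : linear (completed_product c).
Proof.
move=> a b d; apply: extended_rep_faithful => i Ci x.
rewrite linearP -[RHS]/(a *: Th i _ x + Th i _ x) !completed_productE //.
by rewrite linearP -[bl_fun (_ + _) x]/(a *: Th i b x + Th i d x) linearP.
Qed.

Lemma completed_product_norm c d : `|completed_product c d| <= `|c| * `|d|.
Proof.
apply: extended_rep_norming => i Ci; apply: bl_norm_ub => [|x].
  by rewrite mulr_ge0.
rewrite completed_productE // (le_trans (bl_norm_le _ _)) // -mulrA.
rewrite ler_pM ?extended_rep_contraction // (le_trans (bl_norm_le _ _)) //.
by rewrite ler_wpM2r ?extended_rep_contraction.
Qed.

(** Both factors are moved to the closure in turn, by continuity of the product. *)
Lemma completed_product_cone (K : set V) :
  (forall v w, K v -> K w -> exists2 u, K u &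
     forall i, C i -> forall x, T i u x = T i v (T i w x)) ->
  forall c d, completion_cone K c -> completion_cone K d ->
    completion_cone K (completed_product c d).
Proof.
move=> Kmul c d Kc Kd; have clC : closed (completion_cone K) by exact: closed_closure.
have cmul := bounded_bilinear_continuous completed_product_linl
  completed_product_linr completed_product_norm.
apply: (closure_image_closed (F := completed_product^~ d) _ clC _ Kc).
  exact: (continuous_pair_l (s := d) cmul).
move=> _ [v Kv <-].
apply: (closure_image_closed (F := completed_product (completion_in v)) _ clC _ Kd).
  exact: (continuous_pair_r (t := completion_in v) cmul).
move=> _ [w Kw <-]; have [u Ku uvw] := Kmul v w Kv Kw.
by rewrite (completed_product_in uvw); exact: completion_cone_in.
Qed.

Section Positivity.
Variables (K : set V) (L : forall i, set (X i)).
Hypothesis K_cone : is_cone K.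
Hypothesis L_closed : forall i, C i -> closed (@L i).
Hypothesis T_positive : forall i v, C i -> K v -> positive_maps (@L i) (@L i) (T i v).

Lemma extended_rep_positive i c : C i -> completion_cone K c ->
  positive_maps (@L i) (@L i) (Th i c).
Proof.
move=> Ci Kc x Lx.
apply: (closure_image_closed (F := fun c => Th i c x) _ (L_closed Ci) _ Kc).
  by move=> c'; apply: (@continuous_comp _ _ _ (Th i) (bl_eval (X i) x));
    exact: bl_continuous.
by move=> _ [v Kv <-]; rewrite extended_repE; exact: T_positive.
Qed.

(** An element of the cone and of its opposite is mapped into a proper cone and its
opposite, hence to zero, by each representation. *)
Lemma completion_cone_proper :
  (forall i, C i -> proper_cone (positive_maps (@L i) (@L i))) ->
  proper_cone (completion_cone K).
Proof.
move=> Lproper; apply/seteqP; split=> [c [Kc KNc]|_ ->] /=; last first.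
  by split; [|rewrite /= oppr0]; exact: cone0 (completion_cone_is_cone K_cone).
apply/eqP; rewrite -normr_le0; apply: extended_rep_norming => i Ci.
suff -> : Th i c = 0 by rewrite normr0.
have : (positive_maps (@L i) (@L i) `&` [set S | positive_maps (@L i) (@L i) (- S)]) (Th i c).
  by split; [|rewrite /= -linearN]; exact: extended_rep_positive.
by rewrite Lproper.
Qed.

(** The order relations and, by norming, the norm are read off in the operator
algebras, where the hypothesis applies. *)
Lemma completion_cone_normal (beta : R) : 0 <= beta ->
  (forall i, C i -> normal_cone (positive_maps (@L i) (@L i)) beta) ->
  normal_cone (completion_cone K) beta.
Proof.
move=> beta0 Lnormal c d Kc Kcd; apply: extended_rep_norming => i Ci.
apply: (le_trans (Lnormal i Ci (Th i c) (Th i d) _ _)).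
- by rewrite /cone_le subr0; apply: extended_rep_positive => //; rewrite -[c]subr0.
- by rewrite /cone_le -linearB; exact: extended_rep_positive.
- by rewrite ler_wpM2l ?extended_rep_contraction.
Qed.

Lemma completion_cone_absolutely_normal (beta : R) : 0 <= beta ->
  (forall i, C i -> absolutely_normal_cone (positive_maps (@L i) (@L i)) beta) ->
  absolutely_normal_cone (completion_cone K) beta.
Proof.
move=> beta0 Lnormal c d Kcd KNcd; apply: extended_rep_norming => i Ci.
apply: (le_trans (Lnormal i Ci (Th i c) (Th i d) _ _)).
- by rewrite /cone_le -linearB; exact: extended_rep_positive.
- rewrite /cone_le -(linearN (Th i)) -(linearB (Th i)).
  exact: extended_rep_positive.
- by rewrite ler_wpM2l ?extended_rep_contraction.
Qed.

End Positivity.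
End FaithfulFamily.

(** * The crossed product *)

Section CrossedProductRepresentations.
Context {R : realType} {G : topologicalGroupType} {A : completeNormedModType R}.
Variables (mu : {measure set (borel G) -> \bar R}).
Variables (mul : A -> A -> A) (alpha : G -> 'B(A, A)) (Apos : set A).
Variable C : covariant_rep mul alpha -> Prop.
Implicit Types rho : covariant_rep mul alpha.
Hypothesis haar : left_haar_measure mu.
Hypothesis dyn : dynamical_system mul alpha Apos.
Hypothesis bddC : uniformly_bounded C.

Let lcG := dyn_group dyn.

(** A constant that serves the whole class: on functions supported in [W] the
crossed seminorm is dominated by the supremum norm. *)
Lemma integrated_form_uniform_bound (W : set G) : compact W ->
  exists2 B, 0 <= B & forall (f : Cc G A) (c : R) rho, C rho -> 0 <= c ->
    (forall s, ~ W s -> f s = 0) -> (forall s, W s -> `|f s| <= c) ->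
    `|integrated_form mu rho f| <= c * B.
Proof.
move=> cW; have [_ [M [nu [M0 nu0 nuW MC]]]] := bddC.
have [N nuN] := nuW W cW.
exists (M * `|N| * fine (mu W)) => [|f c rho Crho c0 f0 fc].
  by rewrite !mulr_ge0 // fine_ge0.
have [piM UN] := MC rho Crho.
rewrite (le_trans (integrated_form_le haar lcG cW f0 c0 M0 (normr_ge0 N) fc piM _)) //.
  by move=> s /nuN/le_trans/(_ (ler_norm N)); exact: le_trans (UN s).
by rewrite !mulrA [c * M]mulrC.
Qed.

Lemma crossed_seminorm_has_sup (f : Cc G A) :
  has_sup [set r | exists2 rho, C rho & r = `|integrated_form mu rho f|].
Proof.
have [[rho0 C0] _] := bddC; split; first by exists `|integrated_form mu rho0 f|, rho0.
have [K cK f0] := Cc_support f.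
have [c c0 fc] := continuous_compact_bounded cK (@Cc_continuous _ _ _ f).
have [B _ fB] := integrated_form_uniform_bound cK.
by exists (c * B) => _ [rho Crho ->]; exact: fB.
Qed.

Lemma crossed_seminorm_ge (f : Cc G A) rho : C rho ->
  `|integrated_form mu rho f| <= crossed_seminorm mu C f.
Proof.
by move=> Crho; apply: (ub_le_sup (crossed_seminorm_has_sup f).2); exists rho.
Qed.

Lemma crossed_seminorm_le (f : Cc G A) (b : R) :
  (forall rho, C rho -> `|integrated_form mu rho f| <= b) ->
  crossed_seminorm mu C f <= b.
Proof.
move=> fb; apply: ge_sup; first exact: (crossed_seminorm_has_sup f).1.
by move=> _ [rho Crho ->]; exact: fb.
Qed.

Let integrated_formD rho (f g : Cc G A) :
  integrated_form mu rho (f + g) = integrated_form mu rho f + integrated_form mu rho g.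
Proof. by have := integrated_form_linear haar lcG rho 1 f g; rewrite !scale1r. Qed.

Let integrated_formZ rho (a : R) (f : Cc G A) :
  integrated_form mu rho (a *: f) = a *: integrated_form mu rho f.
Proof.
have := integrated_form_linear haar lcG rho a f 0.
by rewrite addr0 (linear_at0 (integrated_form_linear haar lcG rho)) addr0.
Qed.

Lemma crossed_seminorm_seminorm : is_seminorm (crossed_seminorm mu C).
Proof.
have le_scale (a : R) f : crossed_seminorm mu C (a *: f) <= `|a| * crossed_seminorm mu C f.
  apply: crossed_seminorm_le => rho Crho; rewrite integrated_formZ normrZ.
  by rewrite ler_wpM2l // crossed_seminorm_ge.
split=> [f g|a f].
  apply: crossed_seminorm_le => rho Crho; rewrite integrated_formD.
  by rewrite (le_trans (ler_normD _ _)) // lerD // crossed_seminorm_ge.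
apply/eqP; rewrite eq_le le_scale /=.
have [->|a0] := eqVneq a 0.
  rewrite normr0 mul0r scale0r; have [[rho0 C0] _] := bddC.
  exact: le_trans (normr_ge0 _) (crossed_seminorm_ge 0 C0).
have := le_scale a^-1 (a *: f).
by rewrite scalerA mulVf // scale1r normfV mulrC ler_pdivlMr ?normr_gt0 // mulrC.
Qed.

Let HC := crossed_seminorm_seminorm.
Let V := crossed_quot HC.
Let q : Cc G A -> V := crossed_q HC.

Let quot_rep_exists rho : exists T : 'B(V, 'B(cov_space rho, cov_space rho)),
  C rho -> (forall f, T (q f) = integrated_form mu rho f) /\ `|T| <= 1.
Proof.
have [Crho|nC] := pselect (C rho); last by exists 0.
have [T TP] := seminorm_factor HC (integrated_form_linear haar lcG rho)
  (fun f => crossed_seminorm_ge f Crho).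
by exists T.
Qed.

(** A contraction with the required values exists for [rho] in [C]; for the others
the choice is arbitrary. *)
Definition quot_rep rho := sval (cid (quot_rep_exists rho)).

Lemma quot_repE rho f : C rho -> quot_rep rho (q f) = integrated_form mu rho f.
Proof. by move=> Crho; rewrite /quot_rep; case: cid => T /= /(_ Crho)[]. Qed.

Lemma quot_rep_contraction rho : C rho -> `|quot_rep rho| <= 1.
Proof. by move=> Crho; rewrite /quot_rep; case: cid => T /= /(_ Crho)[]. Qed.

(** The norm of the quotient is by definition the supremum of these operator norms. *)
Lemma quot_rep_norming (v : V) (b : R) :
  (forall rho, C rho -> `|quot_rep rho v| <= b) -> `|v| <= b.
Proof.
have [f <-] := seminorm_pi_surj v => fb; rewrite seminorm_pi_norm.
apply: crossed_seminorm_le => rho Crho.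
by rewrite -quot_repE //; exact: fb.
Qed.

Lemma quot_rep_convolution f g h : twisted_convolution mu mul alpha f g h ->
  forall rho, C rho -> forall x,
    quot_rep rho (q h) x = quot_rep rho (q f) (quot_rep rho (q g) x).
Proof.
move=> fgh rho Crho x; rewrite !quot_repE //.
exact: integrated_form_multiplicative.
Qed.

Lemma quot_rep_product (v w : V) : exists u,
  forall rho, C rho -> forall x, quot_rep rho u x = quot_rep rho v (quot_rep rho w x).
Proof.
have [f <-] := seminorm_pi_surj v; have [g <-] := seminorm_pi_surj w.
have [h fgh] := twisted_convolution_exists haar dyn f g.
by exists (q h); exact: quot_rep_convolution.
Qed.

Lemma crossed_quot_cone_is_cone : is_cone (crossed_quot_cone HC Apos).
Proof.
have [A0 AD AZ] := alg_cone (dyn_algebra dyn).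
have qlin : linear q := seminorm_pi_linear HC.
split.
- by exists 0 => //; exact: linear_at0.
- move=> _ _ [f fpos <-] [g gpos <-]; exists (f + g) => [s|].
    by apply: AD; [exact: fpos|exact: gpos].
  by have := qlin 1 f g; rewrite !scale1r.
- move=> a _ a0 [f fpos <-]; exists (a *: f) => [s|].
    by apply: AZ => //; exact: fpos.
  by have := qlin a f 0; rewrite (linear_at0 qlin) !addr0.
Qed.

Lemma crossed_quot_cone_product v w :
  crossed_quot_cone HC Apos v -> crossed_quot_cone HC Apos w ->
  exists2 u, crossed_quot_cone HC Apos u &
    forall rho, C rho -> forall x,
      quot_rep rho u x = quot_rep rho v (quot_rep rho w x).
Proof.
move=> [f fpos <-] [g gpos <-].
have [h fgh] := twisted_convolution_exists haar dyn f g.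
exists (q h); last exact: quot_rep_convolution.
exists h => // s; exact: (twisted_convolution_positive haar dyn fgh).
Qed.

Lemma quot_rep_positive rho (L : set (cov_space rho)) v : C rho ->
  is_cone L -> closed L -> positive_rep Apos L -> crossed_quot_cone HC Apos v ->
  positive_maps L L (quot_rep rho v).
Proof.
move=> Crho coneL clL posL [f fpos <-]; rewrite quot_repE //.
exact: (integrated_form_positive haar lcG coneL clL posL).
Qed.

(** [f] is approximated by finite sums of [theta x *: f x]; splitting each value
[f x] into a difference of positive elements splits the sum, since [theta] is
nonnegative. Supports stay in the fixed compact set [W], where the seminorm is
dominated by the supremum norm. *)
Lemma crossed_quot_cone_dense (v : V) (e : R) : generating Apos -> 0 < e ->
  exists p n, [/\ crossed_quot_cone HC Apos p, crossed_quot_cone HC Apos n &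
    `|v - (p - n)| <= e].
Proof.
move=> genA e0; have [f <-] := seminorm_pi_surj v.
have [K cK f0] := Cc_support f.
have [W cW [fW approx]] := tensor_approximation (R := R) lcG.1 lcG.2
  (@Cc_continuous _ _ _ f) cK f0.
have [B B0 fB] := integrated_form_uniform_bound cW.
have d0 : 0 < e / (B + 1) by rewrite divr_gt0 // ltr_wpDl.
have [l [theta [ctheta theta0 thetaW fh]]] := approx _ d0.
have /choice[bn bnP] : forall a : A, exists bn : A * A,
    [/\ Apos bn.1, Apos bn.2 & a = bn.1 - bn.2].
  move=> a; have : cone_differences Apos a by rewrite genA.
  by move=> [b [n [? ? ?]]]; exists (b, n).
have coneA := alg_cone (dyn_algebra dyn).
have sum_Cc (b : G -> A) : (fun t => \sum_(x <- l) theta x t *: b x) \in Cc_pred (A := A).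
  apply: (Cc_intro lcG.1 _ cW) => [|t nWt].
    apply: continuous_big_sum => x t; apply: cvgZ; last exact: cvg_cst.
    exact: ctheta.
  by rewrite big_seq big1 // => x xl; rewrite thetaW // scale0r.
have sum_pos (b : G -> A) : (forall x, Apos (b x)) ->
    Cc_cone Apos (MkCc (sum_Cc b)).
  move=> bpos t; apply: cone_sum => // x _.
  exact: (coneZ coneA (theta0 x t) (bpos x)).
pose p := MkCc (sum_Cc (fun x => (bn (f x)).1)).
pose n := MkCc (sum_Cc (fun x => (bn (f x)).2)).
exists (q p), (q n); split.
- by exists p => //; apply: sum_pos => x; have [] := bnP (f x).
- by exists n => //; apply: sum_pos => x; have [] := bnP (f x).
have qB (g h : Cc G A) : q g - q h = q (g - h).
  have := seminorm_pi_linear HC (-1) h g.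
  by rewrite !scaleN1r addrC => <-; rewrite addrC.
have q_le (w : Cc G A) (c : R) : 0 <= c -> (forall s, ~ W s -> w s = 0) ->
    (forall s, W s -> `|w s| <= c) -> `|q w| <= c * B.
  move=> c0 w0 wc; rewrite seminorm_pi_norm; apply: crossed_seminorm_le => rho Crho.
  exact: fB.
have [w qw wE] : exists2 w : Cc G A, q w = q f - (q p - q n) &
    forall t, w t = f t - \sum_(x <- l) theta x t *: f x.
  exists (f - (p - n)) => [|t]; first by rewrite !qB.
  rewrite -[LHS]/(f t - (p t - n t)) /= -sumrB; congr (_ - _).
  by apply: eq_bigr => x _; rewrite -scalerBr; have [_ _ <-] := bnP (f x).
rewrite -[X in `|X|]qw; apply: (le_trans (q_le w _ (ltW d0) _ _)).
- move=> t nWt; rewrite wE fW // big_seq big1 ?subrr // => x xl.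
  by rewrite thetaW // scale0r.
- by move=> t _; rewrite wE.
by rewrite mulrAC ler_pdivrMr ?ltr_wpDl // ler_wpM2l ?ltW // ltrDl.
Qed.

End CrossedProductRepresentations.

Theorem theorem3p8 (R : realType) (G : topologicalGroupType)
    (mu : {measure set (borel G) -> \bar R})
    (A : completeNormedModType R) (mul : A -> A -> A) (Apos : set A)
    (alpha : G -> 'B(A, A)) (C : covariant_rep mul alpha -> Prop) :
  left_haar_measure mu ->
  dynamical_system mul alpha Apos ->
  uniformly_bounded C ->
  exists HC : is_seminorm (crossed_seminorm mu C),
  [/\
    closed (crossed_cone HC Apos) /\
    (exists cmul : crossed_product HC -> crossed_product HC ->
                   crossed_product HC,
      (forall f g : Cc G A, exists2 h : Cc G A,
         twisted_convolution mu mul alpha f g h &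
         cmul (crossed_in HC f) (crossed_in HC g) = crossed_in HC h) /\
      preordered_banach_algebra cmul (crossed_cone HC Apos)),
    generating Apos -> topologically_generating (crossed_cone HC Apos),
    generating Apos ->
    forall pos : crossed_quot HC -> crossed_quot HC,
      (forall x, crossed_quot_cone HC Apos (pos x)) ->
      (forall x, cone_le (crossed_quot_cone HC Apos) x (pos x)) ->
      (forall u : nat -> crossed_quot HC,
         cauchy (u @ \oo) -> cauchy ((pos \o u) @ \oo)) ->
      generating (crossed_cone HC Apos),
    forall L : (forall rho : covariant_rep mul alpha, set (cov_space rho)),
      (forall rho, C rho -> [/\ is_cone (L rho), closed (L rho),
         positive_rep Apos (L rho) &
         proper_cone (positive_maps (L rho) (L rho))]) ->
      proper_cone (crossed_cone HC Apos) &
    forall (beta : R)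
      (L : forall rho : covariant_rep mul alpha, set (cov_space rho)),
      0 < beta ->
      (forall rho, C rho -> [/\ is_cone (L rho), closed (L rho) &
         positive_rep Apos (L rho)]) ->
      ((forall rho, C rho ->
          normal_cone (positive_maps (L rho) (L rho)) beta) ->
        normal_cone (crossed_cone HC Apos) beta) /\
      ((forall rho, C rho ->
          absolutely_normal_cone (positive_maps (L rho) (L rho)) beta) ->
        absolutely_normal_cone (crossed_cone HC Apos) beta)].
Proof.
move=> haar dyn bddC; have clA := dyn_closed dyn.
pose HC := crossed_seminorm_seminorm haar dyn bddC; exists HC.
have contr := quot_rep_contraction haar dyn bddC.
have norming := @quot_rep_norming _ _ _ mu mul alpha Apos C haar dyn bddC.
have prod := @quot_rep_product _ _ _ mu mul alpha Apos C haar dyn bddC.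
have coneV := crossed_quot_cone_is_cone haar dyn bddC.
split.
- split; first exact: closed_closure.
  exists (completed_product contr norming prod); split.
    move=> f g; have [h fgh] := twisted_convolution_exists haar dyn f g.
    exists h => //; apply: completed_product_in.
    exact: quot_rep_convolution.
  split.
  + exact: completed_productA.
  + exact: completed_product_linl.
  + exact: completed_product_linr.
  + exact: completed_product_norm.
  + exact: completion_cone_is_cone.
  + apply: completed_product_cone => v w.
    exact: crossed_quot_cone_product.
- move=> genA; apply: completion_cone_topologically_generating => v e e0.
  exact: crossed_quot_cone_dense.
- by move=> _ pos; exact: completion_cone_generating.
- move=> L LP; apply: (completion_cone_proper contr norming (L := L)) => //.
  + by move=> rho /LP[].
  + by move=> rho v Crho; have [? ? ? _] := LP rho Crho; exact: quot_rep_positive.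
  + by move=> rho /LP[].
move=> beta L /ltW beta0 LP.
have Lcl rho : C rho -> closed (L rho) by move=> /LP[].
have Lpos rho v : C rho -> crossed_quot_cone HC Apos v ->
    positive_maps (L rho) (L rho) (quot_rep haar dyn bddC rho v).
  by move=> Crho; have [? ? ?] := LP rho Crho; exact: quot_rep_positive.
split=> Lnormal.
- exact: (completion_cone_normal contr norming (L := L)).
- exact: (completion_cone_absolutely_normal contr norming (L := L)).
Qed.
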